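(* Let $G=G_1*\cdots*G_r$, $\mu$, $\pi$, $\rho$, the Galton–Watson tree $\mathbb{T}$, the branching random walk $(X_v)_{v\in\mathbb{T}}$ on $G$, the word length $|\cdot|$, and the rate function $I$ with effective domain $D_I$ be as described in the context, and let all the assumptions listed there hold. Set $$v_{\max}:=\sup\{x\in D_I:\ I(x)\le \log\rho\}.$$ Then $$\lim_{n\to\infty}\frac{\max_{|v|=n}|X_v|}{n}=v_{\max}\qquad\text{almost surely}.$$
   Context: **Group.** Let $r\ge 2$ and let $G_1,\dots,G_r$ be disjoint nontrivial finite groups (possibly isomorphic to each other) with identities $e_k$; $G_k^\times:=G_k\setminus\{e_k\}$. Let $G=G_1*\cdots*G_r$ be their free product, i.e. the set of finite words over $\bigcup_k G_k^\times$ with no two consecutive letters in the same $G_k$, together with the empty word $e$, with the group operation concatenation followed by reduction; each $G_k$ is regarded as a subgroup of $G$. For each $k$ let $S_k\subseteq G_k^\times$ be a symmetric generating set of $G_k$, and $S=\bigcup_k S_k$. For $x\in G$, $|x|$ is the word length of $x$ with respect to $S$ (graph distance from $e$ to $x$ in the Cayley graph $\mathrm{Cay}(G,S)$). **Random walk.** Let $\mu=\sum_{i=1}^r\alpha_i\mu_i$, where $\alpha_i\ge 0$, $\sum_i\alpha_i=1$ and $\mu_i$ is a probability measure on $G_i$. Let $(Y_n)_{n\in\mathbb{N}}$ be the random walk on $G$ started at $Y_0=e$ with transition probabilities $p(x,y)=\mu(x^{-1}y)$. **Assumption on the walk.** $\alpha_k>0$ for every $k\in\{1,\dots,r\}$;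 each $\mu_k$ is irreducible on $G_k$; and if $r=2$, at least one of $G_1,G_2$ has cardinality greater than $2$. **Rate function.** For $t\in\mathbb{R}$ let $\Lambda(t)=\lim_{n\to\infty}\frac1n\log\mathbb{E}[e^{t|Y_n|}]$ (the limit exists), and for $x\ge 0$ let $I(x)=\sup_{t\in\mathbb{R}}\{xt-\Lambda(t)\}\in[0,\infty]$; this is the large deviation rate function of $(|Y_n|/n)_n$. Let $D_I=\{x\in[0,\infty): I(x)<\infty\}$. **Branching random walk.** Let $\pi$ be a probability distribution on $\mathbb{N}\cup\{0\}$ with mean $\rho=\sum_k k\pi(k)$, satisfying $1<\rho<\infty$ and $\pi(0)=0$. Let $\mathbb{T}$ be the Galton–Watson tree with offspring distribution $\pi$ (Ulam–Harris labelling, root $\emptyset$); $|v|$ denotes the generation of $v\in\mathbb{T}$ and, for $k\le|v|$, $v_k$ denotes the ancestor of $v$ in generation $k$. Given $\mathbb{T}$, let $(\zeta_v)_{v\in\mathbb{T}}$ be i.i.d. with law $\mu$, and set $X_\emptyset=e$ and $X_v=\zeta_{v_1}\zeta_{v_2}\cdots\zeta_{v}$ for $v\in\mathbb{T}$. The maximum over $|v|=n$ is over vertices $v\in\mathbb{T}$ of generation $n$. *)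

(* Defs.v *)
From HB Require Import structures.
From mathcomp Require Import all_boot all_order all_algebra all_fingroup.
From mathcomp Require Import all_classical all_reals all_analysis.

Set Implicit Arguments.
Unset Strict Implicit.
Unset Printing Implicit Defensive.
Import Order.TTheory GRing.Theory Num.Theory.
Import numFieldNormedType.Exports.

Section FreeProduct.
Local Open Scope group_scope.
Variables (I : finType) (gT : I -> finGroupType).

Local Notation letter := {i : I & gT i}.
Implicit Types (a b : letter) (w u v : seq letter).

(* Letters are nontrivial and consecutive letters lie in different factors. The
   sigma-type [letter] makes the factors disjoint even if some are isomorphic. *)
Definition reduced w : bool :=
  all (fun a => tagged a != 1) w && sorted (fun a b => tag a != tag b) w.

Record freeprod := FreeProd { word :> seq letter; word_reduced : reduced word }.
HB.instance Definition _ := [isSub for word].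
HB.instance Definition _ := [Countable of freeprod by <:].

(* Reduction of the word [g :: w], for [w] already reduced and [g] possibly 1.
   When [tag b == i], [tagged_as (Tagged gT g) b] is [tagged b] cast to [gT i]. *)
Definition push i (g : gT i) w : seq letter :=
  if g == 1 then w else
  if w is b :: w' then
    if tag b == i then
      let h := g * tagged_as (Tagged gT g) b in
      if h == 1 then w' else Tagged gT h :: w'
    else Tagged gT g :: w
  else [:: Tagged gT g].

Definition reduce w : seq letter := foldr (fun a => push (tagged a)) [::] w.

Local Notation pushes v w := (foldr (fun a => push (tagged a)) v w).

Lemma reduced_cons a w : reduced (a :: w) =
  [&& tagged a != 1, (if w is b :: _ then tag a != tag b else true) & reduced w].
Proof.
rewrite /reduced /=; case: w => [|b w] /=; first by rewrite !andbT.
by case: (tagged a != 1); case: (tag a != tag b) => //=; rewrite ?andbF.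
Qed.

Lemma push1 i w : push (1 : gT i) w = w.
Proof. by rewrite /push eqxx. Qed.

Lemma push_cons i (g : gT i) w : reduced (Tagged gT g :: w) -> push g w = Tagged gT g :: w.
Proof.
rewrite reduced_cons /push /= => /and3P[/negPf-> + _].
by case: w => //= b w; rewrite eq_sym => /negPf->.
Qed.

Lemma push_push_cons i (g h : gT i) w :
  push g (Tagged gT h :: w) =
  if g == 1 then Tagged gT h :: w else if g * h == 1 then w else Tagged gT (g * h) :: w.
Proof. by rewrite /push /= eqxx tagged_asE. Qed.

Lemma push_reduced i (g : gT i) w : reduced w -> reduced (push g w).
Proof.
have [->|g1] := eqVneq g 1; first by rewrite push1.
case: w => [|[j h] w]; first by rewrite /push (negPf g1) /reduced /= g1.
have [eji|nij] := eqVneq j i; last first.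
  by rewrite /push (negPf g1) /= (negPf nij) [in X in _ -> X]reduced_cons /= g1 eq_sym nij.
move: h; rewrite eji => h; rewrite (push_push_cons g) (negPf g1).
rewrite !reduced_cons => /and3P[h1 hw rw].
case: eqP => // /eqP gh1; rewrite reduced_cons /= gh1 rw andbT.
by case: (w) hw.
Qed.

Lemma push_pushes_reduced w v : reduced v -> reduced (pushes v w).
Proof. by move=> rv; elim: w => //= a w; apply: push_reduced. Qed.

Lemma reduce_reduced w : reduced (reduce w).
Proof. exact: push_pushes_reduced. Qed.

Lemma push_push i (g h : gT i) w : reduced w -> push g (push h w) = push (g * h) w.
Proof.
have pushN (x : gT i) u : is_true (if u is b :: _ then i != tag b else true) -> reduced u ->
    push x u = if x == 1 then u else Tagged gT x :: u.
  move=> iu ru; have [->|x1] := eqVneq x 1; first by rewrite push1.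
  by rewrite push_cons ?(negPf x1)// reduced_cons; apply/and3P; split.
move=> rw; have [->|h1] := eqVneq h 1; first by rewrite push1 mulg1.
have [->|g1] := eqVneq g 1; first by rewrite push1 mul1g.
have [iw|] := boolP (if w is b :: _ then i != tag b else true).
  by rewrite (pushN h)// (pushN (g * h))// (negPf h1) push_push_cons (negPf g1).
case: w rw => // -[j k] w + /=; rewrite negbK => + /eqP ij.
move: k; rewrite -ij => k; rewrite reduced_cons /= => /and3P[k1 iw rw].
rewrite (push_push_cons h) (negPf h1) (push_push_cons (g * h)).
have [hk1|hk1] := eqVneq (h * k) 1.
  rewrite -mulgA hk1 mulg1 pushN// (negPf g1).
  have -> : (g * h == 1) = (g == k).
    by rewrite -(inj_eq (mulIg k)) -mulgA hk1 mulg1 mul1g.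
  by case: eqP => [->|].
rewrite push_push_cons (negPf g1) -mulgA.
have [gh1|//] := eqVneq (g * h) 1.
by rewrite mulgA gh1 mul1g (negPf k1).
Qed.

Lemma pushes_push i (g : gT i) w v : reduced w -> reduced v ->
  pushes v (push g w) = push g (pushes v w).
Proof.
move=> rw rv; have [->|g1] := eqVneq g 1; first by rewrite !push1.
case: w rw => [|[j h] w] rw; first by rewrite push_cons // reduced_cons /= g1.
have [eji|nij] := eqVneq j i; last first.
  by rewrite push_cons// reduced_cons /= g1 eq_sym nij.
move: h rw; rewrite eji => h rw; rewrite (push_push_cons g) (negPf g1) /=.
rewrite push_push ?push_pushes_reduced//.
by case: eqP => [->|_] //; rewrite push1.
Qed.

Lemma pushes_reduce w v : reduced v -> pushes v (reduce w) = pushes v w.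
Proof.
by move=> rv; elim: w => //= a w IH; rewrite pushes_push ?reduce_reduced// IH.
Qed.

Lemma reduce_id w : reduced w -> reduce w = w.
Proof.
elim: w => //= -[i g] w IH rw; rewrite IH ?push_cons//.
by move: rw; rewrite reduced_cons => /and3P[].
Qed.

Lemma reduce_cat w v : reduce (w ++ v) = pushes (reduce v) w.
Proof. by rewrite /reduce foldr_cat. Qed.

Definition fp_one : freeprod := @FreeProd [::] isT.

Definition fp_mul (x y : freeprod) : freeprod :=
  FreeProd (reduce_reduced (word x ++ word y)).

Definition letter_inv a : letter := Tagged gT (tagged a)^-1.

Lemma reduced_inv w : reduced w -> reduced (rev (map letter_inv w)).
Proof.
rewrite /reduced all_rev rev_sorted => /andP[aw sw].
rewrite all_map (eq_all (a2 := fun a => tagged a != 1)) ?aw; last first.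
  by move=> a /=; rewrite invg_eq1.
by rewrite sorted_map; apply: sub_sorted sw => a b /=; rewrite eq_sym.
Qed.

Definition fp_inv (x : freeprod) : freeprod :=
  FreeProd (reduced_inv (word_reduced x)).

Lemma fp_mulA : associative fp_mul.
Proof.
move=> x y z; apply: val_inj => /=.
rewrite [LHS]reduce_cat [RHS]reduce_cat pushes_reduce ?reduce_reduced//.
by rewrite (reduce_id (reduce_reduced _)) reduce_cat foldr_cat.
Qed.

Lemma fp_mul1 : left_id fp_one fp_mul.
Proof. by move=> x; apply: val_inj; rewrite /= reduce_id ?word_reduced. Qed.

Lemma fp_mulr1 : right_id fp_one fp_mul.
Proof. by move=> x; apply: val_inj; rewrite /= cats0 reduce_id ?word_reduced. Qed.

Lemma fp_mulV : left_inverse fp_one fp_inv fp_mul.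
Proof.
case=> w rw; apply: val_inj => /=; rewrite reduce_cat reduce_id//.
elim: w rw => //= -[i g] w IH; rewrite reduced_cons => /and3P[g1 _ rw].
by rewrite rev_cons foldr_rcons /= push_push_cons invg_eq1 (negPf g1) mulVg eqxx IH.
Qed.

Lemma fp_invK : involutive fp_inv.
Proof.
case=> w rw; apply: val_inj => /=; rewrite map_rev revK -map_comp map_id_in//.
by case=> i g _ /=; rewrite /letter_inv/= invgK.
Qed.

Lemma fp_mulrV : right_inverse fp_one fp_inv fp_mul.
Proof. by move=> x; rewrite -{1}(fp_invK x) fp_mulV. Qed.

HB.instance Definition _ := isGroup.Build freeprod
  fp_mulA fp_mul1 fp_mulr1 fp_mulV fp_mulrV.

Definition fp_in i (g : gT i) : freeprod :=
  FreeProd (reduce_reduced [:: Tagged gT g]).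

Lemma fp_inM i : {morph @fp_in i : g h / g * h}.
Proof.
move=> g h; apply: val_inj => /=.
by rewrite reduce_cat pushes_push ?reduce_id ?push_reduced//= push_push.
Qed.

Lemma fp_in_inj i : injective (@fp_in i).
Proof.
move=> g h /(congr1 val); rewrite /= /push.
case: eqP => [->|_]; case: eqP => [->|_] // /eqP.
by rewrite eqseq_cons -tag_eqE /tag_eq/= eqxx tagged_asE /= andbT => /eqP.
Qed.

End FreeProduct.

Arguments fp_in {I gT i} g.

Section WordLength.
Local Open Scope group_scope.

(* 0 when [x] and [y] are not connected. *)
Definition graph_dist (V : eqType) (adj : rel V) (x y : V) : nat :=
  let has_path n := `[< exists p, [/\ size p = n, path adj x p & last x p = y] >] in
  if pselect (exists n, has_path n) is left ex then ex_minn ex else 0.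

Definition cayley (G : groupType) (S : pred G) : rel G :=
  fun x y => S (x^-1 * y).

Definition word_length (G : groupType) (S : pred G) (x : G) : nat :=
  graph_dist (cayley S) 1 x.

Definition fp_gens (I : finType) (gT : I -> finGroupType)
    (S : forall i, {set gT i}) : pred (freeprod gT) :=
  fun x => [exists i, [exists s in S i, x == fp_in s]].

End WordLength.

Local Open Scope classical_set_scope.
Local Open Scope ring_scope.

Section RandomWalk.
Variable R : realType.

Fixpoint nstep (H : finGroupType) (mu : H -> R) (n : nat) (x y : H) : R :=
  if n is n'.+1 then \sum_z mu (x^-1 * z)%g * nstep mu n' z y else (x == y)%:R.

Definition irreducible_walk (H : finGroupType) (mu : H -> R) : Prop :=
  forall x y, exists n, 0 < nstep mu n x y.

Definition mixture (I : finType) (gT : I -> finGroupType) (alpha : I -> R)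
    (mu : forall i, gT i -> R) (x : freeprod gT) : R :=
  \sum_i alpha i * \sum_(g : gT i | fp_in g == x) mu i g.

Definition random_walk (G : groupType) (mu : G -> R) d (T : measurableType d)
    (P : probability T R) (Y : nat -> T -> G) : Prop :=
  (forall n x, measurable (Y n @^-1` [set x])) /\
  forall n (y : nat -> G),
    P [set w | forall k, (k <= n)%N -> Y k w = y k] =
    ((y 0%N == 1%g)%:R * \prod_(k < n) mu ((y k)^-1 * y k.+1)%g)%:E.

Definition log_mgf_rate d (T : measurableType d) (P : probability T R)
    (D : nat -> T -> nat) (t : R) : R :=
  limn (fun n => n%:R^-1 * ln (fine 'E_P[fun w => expR (t * (D n w)%:R)])).

Definition legendre (L : R -> R) (x : R) : \bar R :=
  ereal_sup [set (x * t - L t)%:E | t in [set: R]].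

Definition legendre_dom (L : R -> R) : set R :=
  [set x | 0 <= x /\ (legendre L x < +oo)%E].

End RandomWalk.

Section BranchingRandomWalk.

(* Ulam-Harris labels: the root is [[::]], and the children of [v] are
   [rcons v j] for [j < N v]; the ancestor of [v] in generation k is [take k v]. *)
Definition in_tree (N : seq nat -> nat) (v : seq nat) : bool :=
  all (fun k => nth 0%N v k < N (take k v))%N (iota 0 (size v)).

Fixpoint generation (N : seq nat -> nat) (n : nat) : seq (seq nat) :=
  if n is n'.+1 then
    [seq rcons v j | v <- generation N n', j <- iota 0 (N v)]
  else [:: [::]].

Lemma in_tree_rcons N v j : in_tree N (rcons v j) = in_tree N v && (j < N v)%N.
Proof.
rewrite /in_tree size_rcons -addn1 iotaD all_cat /= andbT nth_rcons ltnn eqxx.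
congr (_ && _); last by rewrite -cats1 take_size_cat.
apply: eq_in_all => k; rewrite mem_iota add0n => /= kv.
by rewrite nth_rcons kv -cats1 takel_cat// ltnW.
Qed.

Lemma mem_generation N n v :
  (v \in generation N n) = (size v == n) && in_tree N v.
Proof.
elim: n v => [|n IH] v /=.
  by rewrite inE; case: v.
case/lastP: v => [|v j].
  by apply/allpairsPdep => -[v [j [_ _ /(congr1 size)]]]; rewrite size_rcons.
rewrite size_rcons eqSS in_tree_rcons andbA -IH.
apply/allpairsPdep/andP => [[u [k [uG kN /rcons_inj[-> ->]]]]|[vG jN]].
  by rewrite uG; split=> //; rewrite mem_iota in kN.
by exists v, j; rewrite mem_iota.
Qed.

Lemma generation_uniq N n : uniq (generation N n).
Proof.
elim: n => //= n IH; apply: allpairs_uniq_dep => // [v _|]; first exact: iota_uniq.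
by move=> [v j] [u k] _ _ /= /rcons_inj[-> ->].
Qed.

Context {R : realType} {d : measure_display} {T : measurableType d}.
Variable P : probability T R.

Definition iid_with_law (I V : eqType) (X : I -> T -> V) (p : V -> R) : Prop :=
  (forall i x, measurable (X i @^-1` [set x])) /\
  forall (F : seq I) (x : I -> V), uniq F ->
    P [set w | forall i, i \in F -> X i w = x i] = (\prod_(i <- F) p (x i))%:E.

(* Conditionally on the random tree, the family [zeta], restricted to the
   vertices of the tree, is i.i.d. with law [p]; the values of [zeta] outside
   the tree are irrelevant. The events [E] range over the sigma-algebra
   generated by the tree. *)
Definition iid_given_tree (V : eqType) (N : seq nat -> T -> nat)
    (zeta : seq nat -> T -> V) (p : V -> R) : Prop :=
  let tree w := in_tree (N^~ w) in
  (forall v x, measurable (zeta v @^-1` [set x])) /\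
  forall (E : set T) (F : seq (seq nat)) (x : seq nat -> V),
    <<s [set [set w | tree w v] | v in [set: seq nat]] >> E -> uniq F ->
    P (E `&` [set w | forall v, v \in F -> tree w v /\ zeta v w = x v]) =
    (P (E `&` [set w | forall v, v \in F -> tree w v]) *
      (\prod_(v <- F) p (x v))%:E)%E.

Definition brw (G : groupType) (zeta : seq nat -> T -> G) (v : seq nat) (w : T) : G :=
  (\prod_(1 <= k < (size v).+1) zeta (take k v) w)%g.

Definition max_displacement (G : groupType) (len : G -> nat)
    (N : seq nat -> T -> nat) (zeta : seq nat -> T -> G) (n : nat) (w : T) : nat :=
  (\max_(v <- generation (N^~ w) n) len (brw zeta v w))%N.

End BranchingRandomWalk.

(* Main.v *)
Require Import Defs.
From HB Require Import structures.
From mathcomp Require Import all_boot all_order all_algebra all_fingroup.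
From mathcomp Require Import all_classical all_reals all_analysis.
From mathcomp Require Import measurable_realfun ring lra zify.

Set Implicit Arguments.
Unset Strict Implicit.
Unset Printing Implicit Defensive.
Import Order.TTheory GRing.Theory Num.Theory.
Import numFieldNormedType.Exports.
Local Open Scope classical_set_scope.
Local Open Scope ring_scope.

(** Why the maximum moves at speed vmax.

Write lambda = ln rho, L_n(t) for the expectation of exp(t |Y_n|), and Lambda
for the limit of (1/n) ln L_n.  The word length is subadditive, so ln L_n is
subadditive for t >= 0 and superadditive for t <= 0: Lambda exists everywhere
([fekete]) and, for t >= 0, Lambda(t) <= (1/n) ln L_n(t) for every n.  Jensen's
inequality gives Lambda(t) >= t v, where v is the limit of E|Y_n| / n.  Hence
I(v) <= 0, so that vmax >= v is finite; above vmax the inequality I > lambda is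
witnessed by some t > 0; and x < vmax lies below some x' with
t x' <= lambda + Lambda(t) for all t >= 0 ([rate_speed_fin]).

Upper bound ([displacement_upper]).  The expected number of vertices of
generation n with |X_v| >= x n is at most rho^n P(|Y_n| >= x n), which by
Markov's inequality decays exponentially as soon as lambda + Lambda(t) < t x
for some t > 0; conclude by Borel-Cantelli.

Lower bound ([displacement_lower]).  Length is not additive in general, but
fix a factor i1 and call a word good if its first letter lies in G_i1 and its
last one does not (or if it is empty).  Good words concatenate without
cancellation, so their lengths add up, and every word becomes good, and not
shorter, after multiplication on either side by one of finitely many words
that the walk reaches with positive probability ([complete_good]).  So the
moment generating function restricted to good words is supermultiplicative and
comparable to L_n ([gmgf_exists]); by Cramer's theorem, in an elementary form
for finite measures ([cramer_lower]), for every x < vmax there is a block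
length b such that rho^b P(Y_b good, |Y_b| >= x b) > 1 ([good_block]).

Following only those descendants whose increments over successive blocks are
good and long gives a supercritical branching process embedded in the tree,
and at the ends of a surviving line of j blocks the length has grown by at
least j b x.  All the subtrees rooted in generation k have independent chances
to contain such a line, and since pi(0) = 0 the probability that all of them
fail is at most theta^k for some theta < 1 ([surv_restart]).  Taking k a small
proportion of n and using Borel-Cantelli again gives the lower bound.

All the probabilities of branching events are computed from finite
configurations: trees truncated to K children per vertex, of a given depth,
with labelled edges.  The hypotheses on the tree and on the steps give the
probability of each configuration as a product ([prob_conf]), and summing
these products yields a recursion in the generating function of the truncated
offspring law ([sum_conf_fails]). *)

(** * Word length in a free product *)

Section WordLengthTheory.
Local Open Scope group_scope.
Variables (G : groupType) (S : pred G).

Definition gen_word (x : G) (s : seq G) : Prop := all S s /\ \prod_(y <- s) y = x.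

Lemma cayley_path_word n (x y : G) :
  (exists p, [/\ size p = n, path (cayley S) x p & last x p = y]) <->
  exists2 s, size s = n & gen_word (x^-1 * y) s.
Proof.
elim: n x => [|n IH] x.
  split=> [[[|? ?] [// _ _ <-]]|[[|? ?] // _ [_ ]]].
    by exists [::] => //; split; rewrite ?big_nil ?mulVg.
  rewrite big_nil => /(congr1 (fun z => x * z)); rewrite mulg1 mulgA mulgV mul1g => ->.
  by exists [::].
split=> [[[|z p] [//[sp] /= /andP[xz zp] l]]|[[|a s] //[ss] [/= /andP[Sa Ss]]]].
  have [s s1 [s2 s3]] : exists2 s, size s = n & gen_word (z^-1 * y) s.
    by apply/IH; exists p.
  exists ((x^-1 * z) :: s); first by rewrite /= s1.
  split; first by rewrite /= s2 andbT.
  by rewrite big_cons s3 mulgA -(mulgA _ z) mulgV mulg1.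
rewrite big_cons => e.
have [p [p1 p2 p3]] : exists p, [/\ size p = n, path (cayley S) (x * a) p & last (x * a) p = y].
  apply/IH; exists s => //; split=> //.
  by rewrite invgM -mulgA -e mulgA mulVg mul1g.
exists (x * a :: p); split => //=; first by rewrite p1.
by rewrite /cayley mulgA mulVg mul1g Sa.
Qed.

(** Without the existence of a word, [graph_dist] returns its default value 0. *)
Lemma word_lengthP (x : G) : (exists s, gen_word x s) ->
  (exists2 s, size s = word_length S x & gen_word x s) /\
  forall s, gen_word x s -> (word_length S x <= size s)%N.
Proof.
move=> [s0 s0x]; rewrite /word_length /graph_dist.
case: pselect => [ex|]; last first.
  move=> H; exfalso; apply: H; exists (size s0); apply/asboolP/cayley_path_word.
  by exists s0; rewrite // invg1 mul1g.
case: ex_minnP => n /asboolP/cayley_path_word; rewrite invg1 mul1g => -[s sn sx] H.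
split; first by exists s.
move=> t tx; apply: H; apply/asboolP/cayley_path_word; exists t => //.
by rewrite invg1 mul1g.
Qed.

Hypothesis Sgen : forall x, exists s, gen_word x s.

Lemma word_length_le x s : gen_word x s -> (word_length S x <= size s)%N.
Proof. exact: (word_lengthP (Sgen x)).2. Qed.

Lemma word_length_word x : exists2 s, size s = word_length S x & gen_word x s.
Proof. exact: (word_lengthP (Sgen x)).1. Qed.

Lemma word_length1 : word_length S 1 = 0.
Proof.
by apply/eqP; rewrite -leqn0 (word_length_le (s := [::]))//; split; rewrite ?big_nil.
Qed.

Lemma word_lengthM x y : (word_length S (x * y) <= word_length S x + word_length S y)%N.
Proof.
have [s <- [s1 s2]] := word_length_word x; have [t <- [t1 t2]] := word_length_word y.
rewrite -size_cat; apply: word_length_le; split; first by rewrite all_cat s1.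
by rewrite big_cat s2 t2.
Qed.

Lemma word_length_prod (I : Type) (r : seq I) (F : I -> G) :
  (word_length S (\prod_(i <- r) F i) <= \sum_(i <- r) word_length S (F i))%N.
Proof.
elim: r => [|i r IH]; rewrite ?big_nil ?word_length1// !big_cons.
by apply: leq_trans (word_lengthM _ _) _; rewrite leq_add2l.
Qed.

Lemma word_lengthV x : (forall s, S s -> S s^-1) -> word_length S x^-1 = word_length S x.
Proof.
move=> SV.
suff H z : (word_length S z^-1 <= word_length S z)%N.
  by apply/eqP; rewrite eqn_leq H -{1}(invgK x) H.
have [s <- [s1 s2]] := word_length_word z.
rewrite -(size_map (fun a : G => a^-1)) -size_rev; apply: word_length_le; split.
  by rewrite all_rev all_map; apply: sub_all s1 => a; exact: SV.
rewrite -s2; elim: (s) => [|a s' IH]; first by rewrite !big_nil invg1.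
by rewrite /= rev_cons -cats1 big_cat big_seq1 big_cons invgM IH.
Qed.

End WordLengthTheory.

Section FreeProductLength.
Local Open Scope group_scope.
Variables (I : finType) (gT : I -> finGroupType) (S : forall i, {set gT i}).
Hypothesis S_symmetric : forall i s, s \in S i -> s^-1 \in S i.
Hypothesis S_generates : forall i, <<S i>> = [set: gT i]%SET.

Local Notation letter := {i : I & gT i}.
Local Notation flen i := (word_length (fun g : gT i => g \in S i)).
Local Notation len := (word_length (fp_gens S)).

Lemma factor_gen i (g : gT i) : exists s, gen_word (fun g => g \in S i) g s.
Proof.
have : g \in <<S i>> by rewrite S_generates inE.
case/gen_prodgP => n [c cS ->]; exists [seq c j | j <- index_enum (ordinal n)]; split.
  by apply/allP => _ /mapP[j _ ->].
by rewrite big_map.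
Qed.

Definition letter_len (a : letter) : nat := flen (tag a) (tagged a).
Definition letters_len (w : seq letter) : nat := \sum_(a <- w) letter_len a.

Lemma letters_len_cons a w : letters_len (a :: w) = (letter_len a + letters_len w)%N.
Proof. exact: big_cons. Qed.

Lemma letters_len_cat w v : letters_len (w ++ v) = (letters_len w + letters_len v)%N.
Proof. exact: big_cat. Qed.

(** Merging a letter into the first letter of a word is a multiplication in one
factor, where the triangle inequality applies. *)
Lemma letters_len_push i (g : gT i) w : (letters_len (push g w) <= letter_len (Tagged gT g) + letters_len w)%N.
Proof.
rewrite /push; case: eqP => [_|_]; first exact: leq_addl.
case: w => [|[j h] w]; first by rewrite letters_len_cons.
case: (eqVneq (tag (Tagged gT h)) i) => [|_]; last by rewrite letters_len_cons.
rewrite /= => ji; case: _ / (esym ji) h => h.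
rewrite tagged_asE letters_len_cons addnA.
case: ifP => _; first exact: leq_addl.
rewrite letters_len_cons leq_add2r /letter_len /=.
exact/word_lengthM/factor_gen.
Qed.

Lemma letters_len_reduce w : (letters_len (reduce w) <= letters_len w)%N.
Proof.
elim: w => //= -[i g] w IH; apply: leq_trans (letters_len_push _ _) _.
by rewrite letters_len_cons leq_add2l.
Qed.

Lemma fp_inV i (g : gT i) : (fp_in g)^-1 = fp_in g^-1.
Proof.
apply: (mulIg (fp_in g)); rewrite mulVg -fp_inM mulVg.
by apply: val_inj; rewrite /= push1.
Qed.

Lemma fp_in1 i : fp_in (1 : gT i) = 1.
Proof. by apply: val_inj; rewrite /= push1. Qed.

Lemma fp_in_prod i (s : seq (gT i)) : fp_in (\prod_(g <- s) g) = \prod_(g <- s) fp_in g.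
Proof.
elim: s => [|g s IH]; first by rewrite !big_nil fp_in1.
by rewrite !big_cons fp_inM IH.
Qed.

Lemma fp_consE i (g : gT i) w (r : reduced (Tagged gT g :: w)) (r' : reduced w) :
  FreeProd r = fp_in g * FreeProd r'.
Proof.
apply: val_inj => /=; rewrite reduce_cat reduce_id//.
have g1 : reduced [:: Tagged gT g].
  by move: r; rewrite !reduced_cons => /and3P[-> _ _].
by rewrite push_cons//= push_cons.
Qed.

Lemma factor_word_fp i (g : gT i) s : gen_word (fun g => g \in S i) g s ->
  gen_word (fp_gens S) (fp_in g) (map (@fp_in _ _ i) s).
Proof.
move=> [s1 s2]; split; last by rewrite big_map -fp_in_prod s2.
rewrite all_map; apply: sub_all s1 => a aS /=.
by apply/existsP; exists i; apply/exists_inP; exists a.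
Qed.

Lemma fp_gen (x : freeprod gT) : exists2 s, size s = letters_len x & gen_word (fp_gens S) x s.
Proof.
case: x => w rw; rewrite /=; elim: w rw => [|[i g] w IH] r.
  exists [::]; first by rewrite /letters_len big_nil.
  by split=> //; rewrite big_nil; apply: val_inj.
have r' : reduced w by move: r; rewrite reduced_cons => /and3P[].
have [s s1 [s2 s3]] := IH r'; rewrite (fp_consE r r').
have [t t1 t2] := word_length_word (@factor_gen i) g.
have [t3 t4] := factor_word_fp t2.
exists (map (@fp_in _ _ i) t ++ s).
  by rewrite size_cat s1 size_map t1 letters_len_cons.
by split; [rewrite all_cat t3 | rewrite big_cat s3 t4].
Qed.

Lemma fp_gen_ex (x : freeprod gT) : exists s, gen_word (fp_gens S) x s.
Proof. by have [s _ ?] := fp_gen x; exists s. Qed.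

Lemma letters_len_mul (x y : freeprod gT) : (letters_len (x * y)%g <= letters_len x + letters_len y)%N.
Proof. by rewrite -letters_len_cat; exact: letters_len_reduce. Qed.

(** Each letter can be spelled separately with the generators of its own factor;
conversely, multiplication by a generator changes the sum of the lengths of
the letters by at most 1. *)
Lemma len_letters (x : freeprod gT) : len x = letters_len x.
Proof.
have [s s1 s2] := fp_gen x.
apply/eqP; rewrite eqn_leq -{1}s1 (word_length_le fp_gen_ex s2)/=.
have [{s1 s2} t <- [t1 t2]] := word_length_word fp_gen_ex x.
rewrite -t2; elim: t t1 {t2} => [|a t IH] /=; first by rewrite big_nil /letters_len big_nil.
move=> /andP[/existsP[i /exists_inP[g gS /eqP->]] /IH tl].
rewrite big_cons; apply: leq_trans (letters_len_mul _ _) _; rewrite -add1n leq_add//.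
rewrite (leq_trans (letters_len_push _ _))// /letters_len big_nil addn0 /letter_len /=.
rewrite (word_length_le (@factor_gen i) (s := [:: g]))//.
by split; rewrite /= ?gS ?big_seq1.
Qed.

Lemma lenM (x y : freeprod gT) : (len (x * y)%g <= len x + len y)%N.
Proof. exact/word_lengthM/fp_gen_ex. Qed.

Lemma fp_gens_sym s : fp_gens S s -> fp_gens S s^-1.
Proof.
move=> /existsP[i /exists_inP[g gS /eqP->]].
apply/existsP; exists i; apply/exists_inP; exists g^-1; first exact: S_symmetric.
by rewrite fp_inV.
Qed.

Lemma lenV (x : freeprod gT) : len x^-1 = len x.
Proof. by apply: word_lengthV; [exact: fp_gen_ex|exact: fp_gens_sym]. Qed.

Lemma len_cat (x y : freeprod gT) : reduced (word x ++ word y) ->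
  len (x * y)%g = (len x + len y)%N /\ word (x * y)%g = word x ++ word y.
Proof.
move=> r; have e : word (x * y)%g = word x ++ word y by rewrite /= reduce_id.
by rewrite !len_letters e letters_len_cat.
Qed.

Lemma reduced_cat (u v : seq letter) : reduced u -> reduced v ->
  (if ohead v is Some b then if ohead (rev u) is Some a then tag a != tag b else true else true) ->
  reduced (u ++ v).
Proof.
rewrite /reduced => /andP[u1 u2] /andP[v1 v2] uv; rewrite all_cat u1 v1 /=.
case: v v1 v2 uv => [|b v] v1 v2; first by rewrite cats0.
case: u u1 u2 => [|a u] u1 u2 //= uv; rewrite cat_path.
move: u2 v2 uv => /= -> -> ; rewrite andbT /=.
by rewrite (lastI a u) rev_rcons.
Qed.

Section Good.
Variable i1 : I.

(** Asymmetric end conditions on the two ends make the class closed under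
products: the last letter of one good word and the first letter of the next
one lie in different factors. *)
Definition good (x : freeprod gT) : bool :=
  (if ohead (word x) is Some b then tag b == i1 else true) &&
  (if ohead (rev (word x)) is Some a then tag a != i1 else true).

Lemma good1 : good 1. Proof. by []. Qed.

Lemma good_mul x y : good x -> good y ->
  good (x * y) /\ len (x * y) = (len x + len y)%N.
Proof.
move=> /andP[x1 x2] /andP[y1 y2].
have /len_cat[e w] : reduced (word x ++ word y).
  apply: reduced_cat; try exact: word_reduced.
  case: (ohead (word y)) y1 => // b /eqP ->; move: x2.
  by case: ohead.
split=> //; rewrite /good w rev_cat.
case: (word x) x1 x2 => [|a u] x1 x2; first by rewrite cats0 y1 y2.
rewrite x1; case: (lastP (word y)) y2 => [|v b]; first by rewrite x2.
by rewrite rev_rcons.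
Qed.

Lemma word_fp_in i (g : gT i) : g != 1 -> word (fp_in g) = [:: Tagged gT g].
Proof. by move=> g1; rewrite /= push_cons// reduced_cons /= g1. Qed.

(** On the left, [a] is enough if the first letter of [x] is not in the factor of
[a], and otherwise [b] separates them; on the right, only a last letter in the
factor of [a] has to be corrected, by [b]. *)
Lemma complete_good i2 (a : gT i1) (b : gT i2) : i2 != i1 -> a != 1 -> b != 1 ->
  forall x, exists c : bool * bool,
    let y := (if c.1 then fp_in a * fp_in b else fp_in a) * x *
             (if c.2 then fp_in b else 1) in
    good y /\ (len x <= len y)%N.
Proof.
move=> i21 a1 b1 x.
have wa := word_fp_in a1; have wb := word_fp_in b1.
have wab : word (fp_in a * fp_in b) = [:: Tagged gT a; Tagged gT b].
  by rewrite (len_cat _).2 ?wa ?wb// !reduced_cons /= a1 b1 /= eq_sym i21.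
(* An empty [x] is completed to [ab] on the left, hence the default [true]. *)
pose c1 := if ohead (word x) is Some l then tag l == i1 else true.
pose c2 := if ohead (rev (word x)) is Some l then tag l == i1 else false.
exists (c1, c2) => /=.
set f := if c1 then _ else _; set g := if c2 then _ else _.
have fx : reduced (word f ++ word x).
  apply: reduced_cat; try exact: word_reduced.
  rewrite /f /c1; case: (word x) => [|l w] //=.
  by case: eqP => [->|/eqP]; rewrite ?wab ?wa //= eq_sym.
have [e1 w1] := len_cat fx.
have wf : exists u, word f = Tagged gT a :: u.
  by rewrite /f; case: ifP => _; rewrite ?wab ?wa; eexists.
have fxg : reduced (word (f * x) ++ word g).
  apply: reduced_cat; try exact: word_reduced.
  rewrite w1 rev_cat /g /c2; case: (rev (word x)) => [|l w] //=.
  by case: eqP => [->|//]; rewrite wb /= eq_sym.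
have [e2 w2] := len_cat fxg; split; last first.
  by rewrite e2 e1; lia.
rewrite /good w2 w1; have [u wu] := wf; rewrite wu /= eqxx /=.
rewrite -!cat_cons !rev_cat /g /c2.
case: (lastP (word x)) @c1 @f {wf} wu fx e1 w1 e2 w2 fxg => [|w l] c1 f wu *.
  move: wu; have -> : f = fp_in a * fp_in b by [].
  by rewrite wab => -[<-].
by rewrite !rev_rcons /=; case: eqP => [lE|/eqP nl]; rewrite ?wb //= eq_sym.
Qed.

End Good.
End FreeProductLength.

(** * Expectations along the random walk *)
Section WalkOperator.
Variables (R : realType) (A : finType) (G : groupType) (e : A -> G) (p : A -> R).
Hypothesis p_ge0 : forall a, 0 <= p a.
Implicit Types (f g h : G -> R) (n m : nat) (x y : G).

(** The expectation of [f] at time [n] for the walk started at [x]; the law of a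
step is carried by the finite alphabet [A], so that all sums are finite. *)
Fixpoint walkE n f x : R :=
  if n is n'.+1 then \sum_a p a * walkE n' f (x * e a)%g else f x.

Lemma eq_walkE n f g x : f =1 g -> walkE n f x = walkE n g x.
Proof.
move=> fg; elim: n x => [|n IH] x //=.
by apply: eq_bigr => a _; rewrite IH.
Qed.

Lemma le_walkE n f g x : (forall y, f y <= g y) -> walkE n f x <= walkE n g x.
Proof.
move=> fg; elim: n x => [|n IH] x //=.
by apply: ler_sum => a _; rewrite ler_wpM2l.
Qed.

Lemma walkE_ge0 n f x : (forall y, 0 <= f y) -> 0 <= walkE n f x.
Proof.
move=> f0; elim: n x => [|n IH] x //=.
by apply: sumr_ge0 => a _; rewrite mulr_ge0.
Qed.

Lemma walkE_addn n m f x : walkE (n + m) f x = walkE n (walkE m f) x.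
Proof.
elim: n x => [|n IH] x //=.
by apply: eq_bigr => a _; rewrite IH.
Qed.

Lemma walkE_shift n f x y : walkE n f (x * y)%g = walkE n (fun z => f (x * z)%g) y.
Proof.
elim: n y => [|n IH] y //=.
by apply: eq_bigr => a _; rewrite -mulgA IH.
Qed.

Lemma walkEZ n f x c : walkE n (fun y => c * f y) x = c * walkE n f x.
Proof.
elim: n x => [|n IH] x //=.
rewrite big_distrr /=; apply: eq_bigr => a _; rewrite IH; ring.
Qed.

Lemma walkEZr n f x c : walkE n (fun y => f y * c) x = walkE n f x * c.
Proof.
by rewrite mulrC -walkEZ; apply: eq_walkE => y; rewrite mulrC.
Qed.

Lemma walkED n f g x : walkE n (fun y => f y + g y) x = walkE n f x + walkE n g x.
Proof.
elim: n x => [|n IH] x //=.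
rewrite -big_split /=; apply: eq_bigr => a _; rewrite IH; ring.
Qed.

Lemma walkE_sum (I : finType) n (f : I -> G -> R) x :
  walkE n (fun y => \sum_i f i y) x = \sum_i walkE n (f i) x.
Proof.
elim: n x => [|n IH] x //=.
rewrite exchange_big /=; apply: eq_bigr => a _.
by rewrite IH big_distrr.
Qed.

(** The increments over disjoint time intervals are independent, so a
supermultiplicative [f] has supermultiplicative expectations. *)
Lemma walkE_mul_ge n m f g h : (forall y, 0 <= g y) ->
  (forall x y, g x * h y <= f (x * y)%g) ->
  walkE n g 1%g * walkE m h 1%g <= walkE (n + m) f 1%g.
Proof.
move=> g0 gh; rewrite walkE_addn mulrC -walkEZ.
apply: le_walkE => x; rewrite mulrC -walkEZ -{2}(mulg1 x) walkE_shift.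
exact: le_walkE.
Qed.

Lemma walkE_mul_le n m f g h : (forall y, 0 <= g y) ->
  (forall x y, f (x * y)%g <= g x * h y) ->
  walkE (n + m) f 1%g <= walkE n g 1%g * walkE m h 1%g.
Proof.
move=> g0 gh; rewrite walkE_addn mulrC -walkEZ.
apply: le_walkE => x; rewrite mulrC -walkEZ -{1}(mulg1 x) walkE_shift.
exact: le_walkE.
Qed.

Hypothesis p_sum1 : \sum_a p a = 1.

Lemma walkE_cst n c x : walkE n (fun=> c) x = c.
Proof.
elim: n x => [|n IH] x //=.
under eq_bigr do rewrite IH.
by rewrite -mulr_suml p_sum1 mul1r.
Qed.

Variables (len : G -> nat) (C : nat).
Hypothesis len1 : len 1%g = 0%N.
Hypothesis lenM : forall x y, (len (x * y)%g <= len x + len y)%N.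
Hypothesis lene : forall a, (len (e a) <= C)%N.

(** After [n] steps the walk is in the ball of radius [C * n]. *)
Lemma le_walkE_ball n f g : (forall y, (len y <= C * n)%N -> f y <= g y) ->
  walkE n f 1%g <= walkE n g 1%g.
Proof.
move=> fg.
suff H m x : (m <= n)%N -> (len x <= C * (n - m))%N -> walkE m f x <= walkE m g x.
  by apply: H; rewrite ?len1.
elim: m x => [|m IH] x mn xl /=; first by apply: fg; rewrite subn0 in xl.
apply: ler_sum => a _; rewrite ler_wpM2l//; apply: IH; first exact: ltnW.
by apply: leq_trans (lenM _ _) _; have := lene a; nia.
Qed.

(** The moment generating function of the word length at time [n]. *)
Definition lmgf n t := walkE n (fun y => expR (t * (len y)%:R)) 1%g.
Definition lmean n := walkE n (fun y => (len y)%:R) 1%g.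

Lemma lmgf_subM n m t : 0 <= t -> lmgf (n + m) t <= lmgf n t * lmgf m t.
Proof.
move=> t0; apply: walkE_mul_le => [y|x y]; first exact: expR_ge0.
by rewrite -expRD ler_expR -mulrDr -natrD ler_wpM2l// ler_nat.
Qed.

Lemma lmgf_superM n m t : t <= 0 -> lmgf n t * lmgf m t <= lmgf (n + m) t.
Proof.
move=> t0; apply: walkE_mul_ge => [y|x y]; first exact: expR_ge0.
by rewrite -expRD ler_expR -mulrDr -natrD ler_wnM2l// ler_nat.
Qed.

Lemma lmgf_ge1 n t : 0 <= t -> 1 <= lmgf n t.
Proof.
move=> t0; rewrite -(walkE_cst n 1 1%g); apply: le_walkE => y.
by rewrite -expR0 ler_expR mulr_ge0.
Qed.

Lemma lmgf_le1 n t : t <= 0 -> lmgf n t <= 1.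
Proof.
move=> t0; rewrite -(walkE_cst n 1 1%g); apply: le_walkE => y.
by rewrite -[leRHS]expR0 ler_expR mulr_le0_ge0.
Qed.

Lemma lmgf_gt0 n t : 0 < lmgf n t.
Proof.
apply: lt_le_trans (_ : expR (- (`|t| * (C * n)%:R)) <= _); first exact: expR_gt0.
rewrite -(walkE_cst n (expR _) 1%g); apply: le_walkE_ball => y yn.
rewrite ler_expR; have : (len y)%:R <= (C * n)%:R :> R by rewrite ler_nat.
have : 0 <= (len y)%:R :> R by [].
have := ler_norm t; have := ler_norm (- t); rewrite normrN; nra.
Qed.

(** Jensen's inequality, from the tangent line of the exponential at the mean. *)
Lemma lmgf_mean n t : expR (t * lmean n) <= lmgf n t.
Proof.
pose m := lmean n.
have -> : expR (t * m) = walkE n (fun y => expR (t * m) * (1 + t * ((len y)%:R - m))) 1%g.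
  rewrite walkEZ walkED walkE_cst walkEZ walkED walkE_cst -/(lmean n) -/m.
  by rewrite subrr mulr0 addr0 mulr1.
apply: le_walkE => y.
have -> : t * (len y)%:R = t * m + t * ((len y)%:R - m) by ring.
by rewrite expRD ler_wpM2l ?expR_ge0// expR_ge1Dx.
Qed.

Lemma lmean_subD n m : lmean (n + m) <= lmean n + lmean m.
Proof.
rewrite /lmean walkE_addn.
have -> : walkE n (fun y => (len y)%:R) 1%g + walkE m (fun y => (len y)%:R) 1%g =
   walkE n (fun x => (len x)%:R + walkE m (fun y => (len y)%:R) 1%g) 1%g.
  by rewrite walkED walkE_cst.
apply: le_walkE => x; rewrite -{1}(mulg1 x) walkE_shift.
rewrite -[X in X + _](walkE_cst m _ 1%g) -walkED.
by apply: le_walkE => y; rewrite -natrD ler_nat.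
Qed.

Lemma lmean_ge0 n : 0 <= lmean n.
Proof. exact: walkE_ge0. Qed.

(** Markov's inequality for the exponential of the length. *)
Lemma tail_mgf n t (b : R) : 0 <= t ->
  walkE n (fun y => (b <= (len y)%:R)%R%:R) 1%g <= expR (- (t * b)) * lmgf n t.
Proof.
move=> t0; rewrite -walkEZ; apply: le_walkE => y.
have [by_|_] /= := leP b; last by rewrite mulr_ge0 ?expR_ge0.
by rewrite -expRD -[leLHS]expR0 ler_expR; nra.
Qed.

End WalkOperator.

(** * A lower bound of Cramer type *)
Section Convolution.
Variables (R : realType) (W : finType).
Implicit Types (g y : W -> R) (f : R -> R) (s t c : R) (m : nat).

(** The integral of [f (s + _)] against the law of a sum of [m] independent copies of
[y] under the finite measure [g], which need not have mass 1. *)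
Fixpoint convE g y m f s : R :=
  if m is m'.+1 then \sum_w g w * convE g y m' f (s + y w) else f s.

Lemma eq_convE g y m f f' s : f =1 f' -> convE g y m f s = convE g y m f' s.
Proof.
by move=> ff; elim: m s => [|m IH] s //=; apply: eq_bigr => w _; rewrite IH.
Qed.

Lemma le_convE g y m f f' s : (forall w, 0 <= g w) -> (forall s, f s <= f' s) ->
  convE g y m f s <= convE g y m f' s.
Proof.
move=> g0 ff; elim: m s => [|m IH] s //=.
by apply: ler_sum => w _; rewrite ler_wpM2l.
Qed.

Lemma convEZ g y m f s c : convE g y m (fun r => c * f r) s = c * convE g y m f s.
Proof.
elim: m s => [|m IH] s //=.
rewrite big_distrr /=; apply: eq_bigr => w _; rewrite IH; ring.
Qed.

Lemma convE_shift g y m f s c :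
  convE g (fun w => y w + c) m f s = convE g y m (fun r => f (r + m%:R * c)) s.
Proof.
elim: m s => [|m IH] s /=; first by rewrite mul0r addr0.
apply: eq_bigr => w _; congr (_ * _); rewrite IH.
have -> : s + (y w + c) = (s + y w) + c by ring.
move: (s + y w) => r {s}.
suff -> : forall h, convE g y m h (r + c) = convE g y m (fun r => h (r + c)) r.
  by apply: eq_convE => u; congr f; rewrite -natr1; ring.
move=> h {IH}; elim: m r => [|m IH] r //=; apply: eq_bigr => v _.
by rewrite -IH addrAC.
Qed.

(** Exponential change of measure; [c] will be the normalizing constant of the
tilted measure. *)
Lemma convE_tilt g y m f s t c : c != 0 ->
  convE g y m f s =
  c ^+ m * convE (fun w => g w * expR (t * y w) / c) y m (fun r => f r * expR (- (t * r))) s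
  * expR (t * s).
Proof.
move=> c0; elim: m s => [|m IH] s /=.
  by rewrite mul1r -mulrA -expRD addNr expR0 mulr1.
rewrite big_distrr big_distrl /=; apply: eq_bigr => w _.
rewrite IH exprS mulrDr expRD; field; exact: c0.
Qed.

(** The variance of a sum of centered independent variables is additive. *)
Lemma convE_sqr g y m s : \sum_w g w = 1 -> \sum_w g w * y w = 0 ->
  convE g y m (fun r => r ^+ 2) s = s ^+ 2 + m%:R * \sum_w g w * y w ^+ 2.
Proof.
move=> g1 gy; elim: m s => [|m IH] s /=; first by rewrite mul0r addr0.
set V := \sum_w g w * y w ^+ 2 in IH *.
under eq_bigr do rewrite IH.
rewrite (eq_bigr (fun w => g w * (s ^+ 2 + m%:R * V) + (2 * s) * (g w * y w) +
    g w * y w ^+ 2)); last by move=> w _; ring.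
rewrite 2!big_split /= -mulr_suml g1 -mulr_sumr gy -/V -natr1; ring.
Qed.

Lemma convE_cst g y m s c : \sum_w g w = 1 -> convE g y m (fun=> c) s = c.
Proof.
move=> g1; elim: m s => [|m IH] s //=; under eq_bigr do rewrite IH.
by rewrite -mulr_suml g1 mul1r.
Qed.

Lemma convED g y m f f' s :
  convE g y m (fun r => f r + f' r) s = convE g y m f s + convE g y m f' s.
Proof.
elim: m s => [|m IH] s //=.
rewrite -big_split /=; apply: eq_bigr => w _; rewrite IH; ring.
Qed.

Lemma expR_le_quad (u : R) : u <= 1 / 2 -> expR u <= 1 + u + 2 * u ^+ 2.
Proof.
move=> u1; have := expR_ge1Dx (- u); rewrite expRN => h.
have e0 := expR_gt0 u.
have {}h : (1 - u) * expR u <= 1.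
  by rewrite -ler_pdivlMr// div1r.
have : (1 - u) * expR u <= (1 - u) * (1 + u + 2 * u ^+ 2).
  apply: le_trans h _; have : 0 <= u ^+ 2 * (1 - 2 * u) by apply: mulr_ge0; [exact: sqr_ge0|lra].
  by lra.
by rewrite ler_pM2l; lra.
Qed.

(** Adding [eps] to [y] makes the moment generating function tend to infinity, so
that its minimum over [0, T] is not attained at [T] if [T] is large.  At a
minimum [t] the derivative [d] vanishes if [t] is positive, and is nonnegative
if [t = 0].  The two cases are used through [t * d = 0]. *)
Lemma mgf_minimum g y (eps : R) : (forall w, 0 <= g w) -> 0 < eps ->
  (forall t, 0 <= t -> 2 <= \sum_w g w * expR (t * y w)) ->
  exists2 t, 0 <= t & exists d,
   let z w := y w + eps in
   [/\ \sum_w g w * expR (t * z w) * z w = d, 0 <= d & t * d = 0].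
Proof.
move=> g0 eps0 H; pose z w := y w + eps.
pose F t := \sum_w g w * expR (t * z w).
have F0 : 0 <= F 0 by apply: sumr_ge0 => w _; rewrite mulr_ge0 ?expR_ge0.
(* With this [T], [F T >= 2 * (1 + T * eps) > F 0]. *)
pose T := F 0 / eps.
have T0 : 0 <= T by apply: divr_ge0 => //; exact: ltW.
have FT : F 0 < F T.
  have : 2 * expR (T * eps) <= F T.
    apply: le_trans (_ : (\sum_w g w * expR (T * y w)) * expR (T * eps) <= _).
      by rewrite ler_wpM2r ?expR_ge0// H.
    rewrite big_distrl /=; apply: ler_sum => w _.
    by rewrite /z mulrDr expRD mulrA.
  have := expR_ge1Dx (T * eps); rewrite /T divfK ?gt_eqF//; lra.
have cF : continuous F.
  move=> t; rewrite /F; apply: cvg_big => [|w _]; first by move=> ?; exact: add_continuous.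
  apply: cvgM; first exact: cvg_cst.
  apply: (cvg_comp (fun t => t * z w) expR); last exact: continuous_expR.
  by apply: cvgM; [exact: cvg_id|exact: cvg_cst].
have [t tT tmin] := EVT_min T0 (continuous_subspaceT cF).
have {tT} /andP[t0 tT] : 0 <= t <= T by rewrite in_itv in tT.
have Ft0 : F t <= F 0 by apply: tmin; rewrite in_itv /= lexx.
have {tT}tT : t < T.
  rewrite lt_neqAle tT andbT; apply/eqP => tE; by move: Ft0; rewrite tE leNgt FT.
exists t => //; pose D := \sum_w g w * expR (t * z w) * z w; exists D.
pose M := \sum_w g w * expR (t * z w) * z w ^+ 2.
have M0 : 0 <= M by apply: sumr_ge0 => w _; rewrite mulr_ge0 ?sqr_ge0// mulr_ge0 ?expR_ge0.
pose B := \sum_w `|z w|.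
have zB w : `|z w| <= B.
  by rewrite /B (bigD1 w)//= lerDl sumr_ge0.
have B0 : 0 <= B by exact: sumr_ge0.
(* Second order expansion of [F] at [t], for perturbations so small that the
     quadratic bound on the exponential applies. *)
have key h : 0 <= t + h <= T -> `|h| * B <= 1 / 2 -> 0 <= h * D + 2 * h ^+ 2 * M.
  move=> hT hB; have : F t <= F (t + h) by apply: tmin; rewrite in_itv.
  suff : F (t + h) <= F t + h * D + 2 * h ^+ 2 * M by lra.
  rewrite /F /D /M !big_distrr -!big_split /=; apply: ler_sum => w _.
  rewrite mulrDl expRD.
  have -> : g w * expR (t * z w) + h * (g w * expR (t * z w) * z w) +
     2 * h ^+ 2 * (g w * expR (t * z w) * z w ^+ 2) =
     g w * expR (t * z w) * (1 + h * z w + 2 * (h * z w) ^+ 2) by ring.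
  rewrite mulrA ler_wpM2l ?mulr_ge0 ?expR_ge0//; apply: expR_le_quad.
  apply: le_trans (ler_norm _) _; rewrite normrM; apply: le_trans hB.
  by rewrite ler_wpM2l.
have small (x y' : R) : 0 < x -> 0 < y' ->
    exists h, [/\ 0 < h, h <= x, h * B <= 1 / 2 & 2 * h * M < y'].
  move=> x0 y0; have x1 : 0 < (2 * (B + 1))^-1 by rewrite invr_gt0; lra.
  have x2 : 0 < y' / (2 * (M + 1)) by rewrite divr_gt0//; lra.
  exists (Num.min x (Num.min (2 * (B + 1))^-1 (y' / (2 * (M + 1))))); split.
  - by rewrite !lt_min x0 x1 x2.
  - by rewrite ge_min lexx.
  - apply: le_trans (_ : (2 * (B + 1))^-1 * B <= _).
      by rewrite ler_wpM2r// !ge_min lexx orbT.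
    by rewrite mulrC ler_pdivrMr; lra.
  - apply: le_lt_trans (_ : 2 * (y' / (2 * (M + 1))) * M < _).
      by rewrite ler_wpM2r// ler_wpM2l// !ge_min lexx !orbT.
    have -> : 2 * (y' / (2 * (M + 1))) * M = y' * M / (M + 1) by field; lra.
    by rewrite ltr_pdivrMr; nra.
have D0 : 0 <= D.
  rewrite leNgt; apply/negP => Dn.
  have [||h [h0 h1 h2 h3]] := small (T - t) (- D); [lra|lra|].
  have : 0 <= h * D + 2 * h ^+ 2 * M.
    by apply: key; rewrite ?gtr0_norm//; lra.
  nra.
split=> //.
have [->|tn0] := eqVneq t 0; first by rewrite mul0r.
have [->|Dn0] := eqVneq D 0; first by rewrite mulr0.
have tp : 0 < t by rewrite lt_def tn0.
have Dp : 0 < D by rewrite lt_def Dn0.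
have [h [h0 h1 h2 h3]] := small t D tp Dp.
have : 0 <= (- h) * D + 2 * (- h) ^+ 2 * M.
  by apply: key; rewrite ?normrN ?gtr0_norm//; lra.
nra.
Qed.

(** At a minimum of the moment generating function the tilted measure has
nonnegative mean and mass at least 2.  By Chebyshev's inequality the sum of [m]
copies concentrates near its mean, and undoing the tilting costs at most a
factor [exp(t * m * eta)], which the mass [2 ^ m] beats for [m] large. *)
Theorem cramer_lower g y (eps : R) : (forall w, 0 <= g w) -> 0 < eps ->
  (forall t, 0 <= t -> 2 <= \sum_w g w * expR (t * y w)) ->
  exists2 m, (0 < m)%N & 1 < convE g y m (fun s => (- (m%:R * eps) <= s)%R%:R) 0.
Proof.
move=> g0 eps0 H.
have e20 : 0 < eps / 2 by rewrite divr_gt0.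
have [t t0 [d /= [dE d0 td]]] := mgf_minimum g0 e20 H.
pose z w := y w + eps / 2.
pose c := \sum_w g w * expR (t * z w).
have c2 : 2 <= c.
  apply: le_trans (H t t0) _; apply: ler_sum => w _.
  by rewrite ler_wpM2l// ler_expR ler_wpM2l// /z lerDl ltW.
have c0 : 0 < c by lra.
pose w' w := g w * expR (t * z w) / c.
have w'0 w : 0 <= w' w by rewrite /w' divr_ge0 ?mulr_ge0 ?expR_ge0// ltW.
have w'1 : \sum_w w' w = 1 by rewrite -mulr_suml -/c divff// gt_eqF.
pose y' w := z w - d / c.
have w'y : \sum_w w' w * y' w = 0.
  rewrite (eq_bigr (fun w => (g w * expR (t * z w) * z w) / c - w' w * (d / c))).
    rewrite big_split /= sumrN -[X in X - _]mulr_suml dE.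
    by rewrite -[X in _ - X]mulr_suml w'1 mul1r subrr.
  by move=> w _; rewrite /y' /w'; ring.
pose V := \sum_w w' w * y' w ^+ 2.
have V0 : 0 <= V by apply: sumr_ge0 => w _; rewrite mulr_ge0 ?sqr_ge0.
(* [eta] is the width of the window in Chebyshev's inequality; the bound
   [t * eta <= 1 / 4] keeps [2 * exp(- t eta)] above [3 / 2]. *)
pose eta := Num.min (eps / 2) (4 * (t + 1))^-1.
have eta0 : 0 < eta by rewrite lt_min e20 invr_gt0; lra.
have eta1 : eta <= eps / 2 by rewrite ge_min lexx.
have eta2 : t * eta <= 1 / 4.
  apply: le_trans (_ : t * (4 * (t + 1))^-1 <= _).
    by rewrite ler_wpM2l// ge_min lexx orbT.
  by rewrite ler_pdivrMr; lra.
(* Chebyshev's inequality then leaves at least half of the mass. *)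
have [m m2 mV] : exists2 m : nat, (2 <= m)%N & 2 * V / eta ^+ 2 <= m%:R.
  exists (2 + Num.bound (2 * V / eta ^+ 2))%N; first by [].
  rewrite natrD; apply: ler_wpDl => //; apply/ltW/archi_boundP.
  by apply: mulr_ge0; [exact: mulr_ge0|rewrite invr_ge0 sqr_ge0].
have m0 : 0 < m%:R :> R by rewrite ltr0n; exact: leq_trans m2.
exists m; first exact: leq_trans m2.
have yE : y = (fun w => z w + - (eps / 2)) by apply/funext => w; rewrite /z addrK.
rewrite {1}yE convE_shift (convE_tilt _ _ _ _ _ t (lt0r_neq0 c0)) mulr0 expR0 mulr1.
have zE : z = (fun w => y' w + d / c) by apply/funext => w; rewrite /y' subrK.
rewrite -/w' zE convE_shift.
(* The indicator of the window is minorized by a quadratic polynomial. *)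
apply: lt_le_trans (_ : c ^+ m * (expR (- (t * (m%:R * eta))) * (1 / 2)) <= _); last first.
  apply: ler_wpM2l; first by rewrite exprn_ge0// ltW.
  apply: le_trans (_ : convE w' y' m (fun r => expR (- (t * (m%:R * eta))) *
      (1 + (- (m%:R * eta) ^- 2) * r ^+ 2)) 0 <= _).
    rewrite convEZ ler_wpM2l ?expR_ge0// convED convE_cst// convEZ convE_sqr//.
    rewrite -/V expr0n add0r.
    have : (m%:R * eta) ^- 2 * (m%:R * V) <= 1 / 2.
      have -> : (m%:R * eta) ^- 2 * (m%:R * V) = (2 * V / eta ^+ 2) / m%:R / 2.
        by field; rewrite ?gt_eqF.
      have : 2 * V / eta ^+ 2 / m%:R <= 1 by rewrite ler_pdivrMr// mul1r.
      by lra.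
    by lra.
  apply: le_convE => // r.
  have [rm|rm] := leP `|r| (m%:R * eta); last first.
    apply: le_trans (_ : 0 <= _); last by rewrite mulr_ge0 ?expR_ge0.
    rewrite mulr_ge0_le0 ?expR_ge0//.
    have : 1 <= (m%:R * eta) ^- 2 * r ^+ 2; last by lra.
    rewrite mulrC ler_pdivlMr ?exprn_gt0 ?mulr_gt0// mul1r -(real_normK (num_real r)).
    by rewrite ler_pXn2r ?nnegrE ?(ltW rm)// ltW// mulr_gt0.
  have /andP[r1 r2] : - (m%:R * eta) <= r <= m%:R * eta by rewrite -ler_norml.
  have -> : - (m%:R * eps) <= r + m%:R * (d / c) + m%:R * - (eps / 2).
    have : 0 <= m%:R * (d / c) by apply: mulr_ge0 => //; apply: divr_ge0 => //; exact: ltW.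
    have : m%:R * eta <= m%:R * (eps / 2) by rewrite ler_wpM2l// ltW.
    by lra.
  rewrite mul1r; apply: le_trans (_ : expR (- (t * (m%:R * eta))) * 1 <= _).
    rewrite ler_wpM2l ?expR_ge0//.
    have : 0 <= (m%:R * eta) ^- 2 * r ^+ 2 by rewrite mulr_ge0 ?sqr_ge0 ?invr_ge0 ?sqr_ge0.
    by lra.
  rewrite mulr1 ler_expR lerN2.
  have -> : t * (r + m%:R * (d / c)) = t * r + (t * d) * (m%:R / c) by ring.
  by rewrite td mul0r addr0 ler_wpM2l.
rewrite mulrA -mulrN1 (_ : t * (m%:R * eta) * -1 = (- (t * eta)) * m%:R); last by ring.
rewrite expRM_natr -exprMn.
have h : 3 / 2 <= c * expR (- (t * eta)).
  have := expR_ge1Dx (- (t * eta)); nra.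
apply: lt_le_trans (_ : (3 / 2) ^+ 2 * (1/2) <= _); first by lra.
rewrite ler_pM2r; last by lra.
apply: le_trans (_ : (3 / 2) ^+ m <= _); first by apply: ler_weXn2l => //; lra.
by rewrite lerXn2r ?nnegrE; lra.
Qed.

End Convolution.

(** * Subadditive limits and the rate function *)
Section Fekete.
Variable R : realType.

Lemma fekete (a : nat -> R) : (forall n, 0 <= a n) ->
  (forall n m, a (n + m)%N <= a n + a m) ->
  exists l, [/\ n%:R^-1 * a n @[n --> \oo] --> l, 0 <= l &
    forall n, (0 < n)%N -> l <= n%:R^-1 * a n].
Proof.
move=> a0 aD.
pose E := [set n%:R^-1 * a n | n in [set n | (0 < n)%N]].
have E0 : E !=set0 by exists (1%:R^-1 * a 1%N), 1%N.
have lbE : lbound E 0 by move=> _ [n _ <-]; rewrite mulr_ge0.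
have hE : has_inf E by split=> //; exists 0.
have Einf n : (0 < n)%N -> inf E <= n%:R^-1 * a n.
  by move=> n0; apply: ge_inf; [exists 0|exists n].
exists (inf E); split=> //; last exact: lb_le_inf.
apply/cvgrPdist_le => eps eps0.
have e20 : 0 < eps / 2 by rewrite divr_gt0.
have [_ [k /= k0 <-] kl] := inf_adherent e20 hE.
have kR : 0 < k%:R :> R by rewrite ltr0n.
pose M := \sum_(i < k) a i.
have M0 : 0 <= M by exact: sumr_ge0.
have aM q : a (q * k)%N <= q%:R * a k + M.
  elim: q => [|q IH]; first by rewrite mul0n mul0r add0r /M (bigD1 (Ordinal k0))//= lerDl sumr_ge0.
  rewrite mulSn; apply: le_trans (aD _ _) _.
  by rewrite -natr1; lra.
(* Split [n] into [n %/ k] blocks of length [k] and a bounded rest. *)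
have aub n : a n <= (n %/ k)%:R * a k + 2 * M.
  rewrite {1}(divn_eq n k); apply: le_trans (aD _ _) _.
  have : a (n %% k)%N <= M.
    by rewrite /M (bigD1 (Ordinal (ltn_pmod n k0)))//= lerDl sumr_ge0.
  by have := aM (n %/ k)%N; lra.
exists (Num.bound (4 * M / eps)).+1 => // n /= nn.
have n0 : (0 < n)%N by lia.
have nR : 0 < n%:R :> R by rewrite ltr0n.
have nM : 4 * M / eps <= n%:R.
  apply: le_trans (_ : (Num.bound (4 * M / eps))%:R <= _); last by rewrite ler_nat ltnW.
  by apply/ltW/archi_boundP; rewrite divr_ge0 ?mulr_ge0// ltW.
have n1 := Einf _ n0.
rewrite distrC ger0_norm ?subr_ge0// lerBlDl mulrC ler_pdivrMr//.
have {kl} kl : a k <= (inf E + eps / 2) * k%:R by rewrite -ler_pdivrMr// mulrC ltW.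
have qk : (n %/ k)%:R * k%:R <= n%:R :> R by rewrite -natrM ler_nat leq_trunc_div.
have i0 : 0 <= inf E + eps / 2 by have := lb_le_inf E0 lbE; lra.
have q0 : 0 <= (n %/ k)%:R :> R by [].
have : 4 * M <= n%:R * eps by rewrite -ler_pdivrMr.
have : (n %/ k)%:R * a k <= (inf E + eps / 2) * n%:R.
  apply: le_trans (_ : (n %/ k)%:R * ((inf E + eps / 2) * k%:R) <= _).
    by rewrite ler_wpM2l.
  by rewrite mulrCA ler_wpM2l.
have := aub n; nra.
Qed.

End Fekete.

Section Rate.
Variables (R : realType) (L : R -> R) (lam v : R).
Hypotheses (lam0 : 0 < lam) (v0 : 0 <= v) (Lv : forall t : R, t * v <= L t).

Definition rate_speed : \bar R :=
  ereal_sup [set x%:E | x in [set x | legendre_dom L x /\ (legendre L x <= lam%:E)%E]].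

Lemma legendre_leP (x c : R) :
  (legendre L x <= c%:E)%E <-> forall t : R, x * t - L t <= c.
Proof.
split=> [H t|H]; last by apply: ge_ereal_sup => _ [t _ <-]; rewrite lee_fin.
by rewrite -lee_fin; apply: le_trans H; apply: ereal_sup_ubound; exists t.
Qed.

Lemma rate_setE (x : R) : (legendre_dom L x /\ (legendre L x <= lam%:E)%E) <->
  0 <= x /\ forall t : R, x * t <= lam + L t.
Proof.
split=> [[[x0 _] /legendre_leP H]|[x0 H]].
  by split=> // t; have := H t; lra.
have : (legendre L x <= lam%:E)%E by apply/legendre_leP => t; have := H t; lra.
by move=> h; split=> //; split=> //; apply: le_lt_trans h _; rewrite ltry.
Qed.

(** The bound [t * v <= L t] serves twice: it puts [v] into the set defining the
supremum, and for [x > v] it excludes that [I x > lam] be witnessed by some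
[t <= 0]. *)
Lemma rate_speed_fin : exists V : R,
  [/\ rate_speed = V%:E, v <= V,
   forall x : R, V < x -> exists2 t : R, 0 < t & lam + L t < t * x &
   forall x : R, x < V -> exists2 x' : R, x < x' & forall t : R, 0 <= t -> t * x' <= lam + L t].
Proof.
pose E : set R := [set x : R | 0 <= x /\ forall t : R, x * t <= lam + L t].
have Ev : E v by split=> // t; rewrite mulrC (le_trans (Lv t))// lerDr ltW.
have Eub : ubound E (lam + L 1) by move=> x [_ /(_ 1)]; rewrite mulr1.
have sE : has_sup E by split; [exists v|exists (lam + L 1)].
have supv : v <= sup E by apply: ub_le_sup => //; exists (lam + L 1).
exists (sup E); split => //.
- rewrite /rate_speed (_ : [set x | _ /\ _] = E); last first.
    by apply/seteqP; split=> x /rate_setE.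
  by rewrite ereal_sup_EFin//; [exists (lam + L 1)|exists v].
- move=> x xV; have nE : ~ E x.
    by move=> xE; have := ub_le_sup sE.2 xE; rewrite leNgt xV.
  have vx : v <= x := le_trans supv (ltW xV).
  have x0 : 0 <= x := le_trans v0 vx.
  have [t tx] : exists t : R, lam + L t < x * t.
    by apply: contra_notP nE => /forallNP H; split=> // t; rewrite leNgt; apply/negP.
  exists t; last by rewrite mulrC.
  rewrite ltNge; apply/negP => t0.
  have : x * t <= lam + L t; last by rewrite leNgt tx.
  apply: le_trans (_ : t * v <= _); first by rewrite mulrC ler_wnM2l.
  by rewrite (le_trans (Lv t))// lerDr ltW.
- move=> x xV; have [x' [_ x'E] xx'] : exists2 x', E x' & x < x'.
    have [|x' Ex' h] := @sup_adherent _ E (sup E - x) _ sE; first by rewrite subr_gt0.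
    by exists x' => //; rewrite opprB addrC subrK in h.
  by exists x' => // t _; rewrite mulrC.
Qed.

End Rate.

(** * Concatenating good words *)
Lemma nat_common_bound (a b c d : nat) :
  exists n, [/\ a <= n, b <= n, c <= n, d <= n & 0 < n]%N.
Proof. by exists (a + b + c + d).+1; split; lia. Qed.

(** The walk on a free product enters only through a class [good] on which the
length is additive, and through finitely many pairs [(l j, r j)] of group
elements that complete any element to a good one and are reached by the walk
at the times [kl j] and [kr j]. *)
Section GoodBlock.
Variables (R : realType) (A : finType) (G : groupType) (e : A -> G) (p : A -> R).
Hypotheses (p_ge0 : forall a, 0 <= p a) (p_sum1 : \sum_a p a = 1).
Variables (len : G -> nat) (C : nat).
Hypothesis len1 : len 1%g = 0%N.
Hypothesis lenM : forall x y, (len (x * y)%g <= len x + len y)%N.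
Hypothesis lene : forall a, (len (e a) <= C)%N.
Variable good : pred G.
Hypothesis good1 : good 1%g.
Hypothesis good_mul : forall x y, good x -> good y ->
  good (x * y)%g /\ len (x * y)%g = (len x + len y)%N.
Variables (J : finType) (l r : J -> G) (kl kr : J -> nat).
Local Notation walkE := (walkE e p).
Local Notation lmgf := (lmgf e p len).
Hypothesis l_gt0 : forall j, 0 < walkE (kl j) (fun y => (y == l j)%:R) 1%g.
Hypothesis r_gt0 : forall j, 0 < walkE (kr j) (fun y => (y == r j)%:R) 1%g.
Hypothesis complete : forall x, exists j,
  good (l j * x * r j)%g /\ (len x <= len (l j * x * r j)%g)%N.

Definition gmgf n (t : R) := walkE n (fun y => (good y)%:R * expR (t * (len y)%:R)) 1%g.

Lemma gmgf_ge0 n t : 0 <= gmgf n t.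
Proof. by apply: walkE_ge0 => // y; rewrite mulr_ge0 ?expR_ge0. Qed.

Lemma gmgf_superM n m t : gmgf n t * gmgf m t <= gmgf (n + m) t.
Proof.
apply: walkE_mul_ge => // x y.
have [gx|_] := boolP (good x); last by rewrite !mul0r mulr_ge0 ?expR_ge0.
have [gy|_] := boolP (good y); last by rewrite mul0r mulr0 mulr_ge0 ?expR_ge0.
have [-> ->] := good_mul gx gy.
by rewrite !mul1r -expRD natrD mulrDr.
Qed.

Lemma gmgf_pow n m t : gmgf n t ^+ m <= gmgf (m * n) t.
Proof.
elim: m => [|m IH]; first by rewrite expr0 mul0n /gmgf /= good1 len1 mulr0 expR0 mulr1.
rewrite exprS mulSn; apply: le_trans (gmgf_superM _ _ _).
by rewrite ler_wpM2l// gmgf_ge0.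
Qed.

Let c j := walkE (kl j) (fun y => (y == l j)%:R) 1%g * walkE (kr j) (fun y => (y == r j)%:R) 1%g.

(** Sort the positions [y] at time [n] according to the pair [j] that completes
them, and let the walk perform [l j] before and [r j] after. *)
Lemma lmgf_le_gmgf n t : 0 <= t -> lmgf n t <= \sum_j gmgf (kl j + n + kr j) t / c j.
Proof.
move=> t0; have /choice[jof H] := complete.
have -> : lmgf n t =
    \sum_j walkE n (fun y => (jof y == j)%:R * expR (t * (len y)%:R)) 1%g.
  rewrite -walkE_sum; apply: eq_walkE => y.
  rewrite (bigD1 (jof y))//= eqxx mul1r big1 ?addr0// => j.
  by rewrite eq_sym => /negPf->; rewrite mul0r.
apply: ler_sum => j _; rewrite ler_pdivlMr ?mulr_gt0// /c mulrCA mulrA.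
apply: le_trans (_ : walkE (kl j + n) (fun y =>
    (jof ((l j)^-1 * y)%g == j)%:R * expR (t * (len ((l j)^-1 * y)%g)%:R)) 1%g *
   walkE (kr j) (fun y => (y == r j)%:R) 1%g <= _).
  rewrite ler_wpM2r ?(ltW (r_gt0 j))//; apply: walkE_mul_ge => // x y.
  have [->|_] := eqVneq x (l j); last by rewrite mul0r mulr_ge0 ?expR_ge0.
  by rewrite mul1r mulgA mulVg mul1g.
apply: walkE_mul_ge => // x y.
have [->|_] := eqVneq y (r j); last by rewrite mulr0 mulr_ge0 ?expR_ge0.
rewrite mulr1; set z := ((l j)^-1 * x)%g.
have [zj|_] := eqVneq (jof z) j; last by rewrite mul0r mulr_ge0 ?expR_ge0.
have := H z; rewrite zj => -[].
rewrite /z mulgA mulgV mul1g -/z => -> zl.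
by rewrite !mul1r ler_expR ler_wpM2l// ler_nat.
Qed.

(** One of the finitely many terms of the previous sum is at least a fixed
proportion of the total. *)
Lemma gmgf_exists : exists2 kappa : R, 0 < kappa & forall n t, 0 <= t ->
  exists j, kappa * lmgf n t <= gmgf (kl j + n + kr j) t.
Proof.
pose S := \sum_j (c j)^-1.
have S0 : 0 <= S by apply: sumr_ge0 => j _; rewrite invr_ge0 mulr_ge0// ltW.
have k0 : 0 < (2 * (S + 1))^-1 by rewrite invr_gt0; lra.
exists (2 * (S + 1))^-1 => // n t t0; apply/not_existsP => H.
have L0 : 0 < lmgf n t by exact: lmgf_gt0 lene _ _.
have := lmgf_le_gmgf n t0; apply/negP; rewrite -ltNge.
apply: le_lt_trans (_ : (2 * (S + 1))^-1 * lmgf n t * S < _).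
  rewrite /S big_distrr /=; apply: ler_sum => j _.
  rewrite ler_wpM2r// ?invr_ge0 ?mulr_ge0 ?ltW//.
  by have /negP := H j; rewrite -ltNge.
rewrite -mulrA mulrCA gtr_pMr// mulrC ltr_pdivrMr; lra.
Qed.

Variables (rho x x' : R).
Hypotheses (rho1 : 1 < rho) (x_ge0 : 0 <= x) (xx' : x < x').
Hypothesis lmgf_lb : forall n t, (0 < n)%N -> 0 <= t ->
  expR (n%:R * (t * x' - ln rho)) <= lmgf n t.

Let rho0 : 0 < rho. Proof. by apply: lt_trans rho1. Qed.
Let lam0 : 0 < ln rho. Proof. by rewrite ln_gt0. Qed.

Let rhoE n : rho ^+ n = expR (n%:R * ln rho).
Proof. by rewrite expRM_natl lnK// posrE. Qed.

Lemma nat_multiple_ge (a b : R) : 0 < a -> exists n0 : nat, forall n, (n0 <= n)%N -> b <= n%:R * a.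
Proof.
move=> a0; exists (Num.bound (`|b| / a)) => n nn.
rewrite -ler_pdivrMr//; apply: le_trans (_ : `|b| / a <= _).
  by rewrite ler_wpM2r ?invr_ge0 ?(ltW a0)// ler_norm.
apply: le_trans (_ : (Num.bound (`|b| / a))%:R <= _); last by rewrite ler_nat.
by apply/ltW/archi_boundP; rewrite divr_ge0// ltW.
Qed.

(** The time at which the good moment generating function is comparable with
[lmgf n t] depends on [t] through [j].  As good words can be repeated, a common
multiple [N] of these finitely many times serves for all [t]. *)
Lemma gmgf_large : exists2 N, (0 < N)%N & forall t, 0 <= t ->
  2 <= rho ^+ N * gmgf N t * expR (- (t * (x * N%:R))).
Proof.
have [kappa k0 Hk] := gmgf_exists.
move: (x_ge0) (xx') (lam0) => x_ge_0 x_lt lam_gt0.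
have [K kK] : exists K, forall j, (kl j + kr j <= K)%N.
  by exists (\sum_j (kl j + kr j))%N => j; rewrite (bigD1 j)//= leq_addr.
have [t0 [t00 t0x]] : exists t0 : R, 0 < t0 /\ t0 * x <= ln rho / 4.
  exists (ln rho / (4 * (x + 1))); split; first by rewrite divr_gt0//; lra.
  have -> : ln rho / (4 * (x + 1)) * x = (ln rho / 4) * (x / (x + 1)) by field; lra.
  by rewrite ler_piMr ?divr_ge0 ?(ltW lam0)// ler_pdivrMr; lra.
have [B BE] : exists B : R, kappa * expR B = 2.
  exists (ln (2 / kappa)); rewrite lnK ?posrE ?divr_gt0// mulrC divfK//.
  by rewrite gt_eqF.
have [n1 H1] := @nat_multiple_ge ((x' - x) / 2) (x * K%:R) ltac:(lra).
have [n2 H2] := @nat_multiple_ge (t0 * ((x' - x) / 2)) B ltac:(rewrite mulr_gt0//; lra).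
have [n3 H3] := @nat_multiple_ge (ln rho / 2) B ltac:(lra).
have [n [nn1 nn2 nn3 Kn n_gt0]] : exists n, [/\ n1 <= n, n2 <= n, n3 <= n, K <= n & 0 < n]%N.
  exact: nat_common_bound.
have {nn1}H1 := H1 n nn1; have {nn2}H2 := H2 n nn2; have {nn3}H3 := H3 n nn3.
have nK : K%:R <= n%:R :> R by rewrite ler_nat.
have n0 : 0 < n%:R :> R by rewrite ltr0n.
pose T j := (kl j + n + kr j)%N.
have T0 j : (0 < T j)%N by rewrite /T !addn_gt0 n_gt0 orbT.
(* For [t >= t0] the gap between [x] and [x'] makes the exponent large; for
   [t <= t0] the term [n * ln rho] alone does, as [lmgf n t >= 1]. *)
have key t : 0 <= t -> exists j, 2 <= rho ^+ T j * gmgf (T j) t * expR (- (t * (x * (T j)%:R))).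
  move=> tt; have [j Hj] := Hk n t tt; exists j.
  have TE : (T j)%:R = n%:R + (kl j + kr j)%:R :> R by rewrite -natrD /T addnAC addnC.
  have kjK : (kl j + kr j)%:R <= K%:R :> R by rewrite ler_nat.
  have kj0 : 0 <= (kl j + kr j)%:R :> R by [].
  have xk : x * (kl j + kr j)%:R <= x * K%:R by rewrite ler_wpM2l.
  have l1 : expR (n%:R * ln rho) <= rho ^+ T j.
    by rewrite rhoE ler_expR ler_wpM2r ?(ltW lam0)// TE; lra.
  suff [u [u1 u2]] : exists u : R, expR u <= lmgf n t /\
      B <= n%:R * ln rho + u - t * (x * (T j)%:R).
    rewrite -BE.
    apply: le_trans (_ : (expR (n%:R * ln rho) * (kappa * expR u)) * expR (- (t * (x * (T j)%:R))) <= _).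
      have -> : expR (n%:R * ln rho) * (kappa * expR u) * expR (- (t * (x * (T j)%:R))) =
        kappa * (expR (n%:R * ln rho) * expR u * expR (- (t * (x * (T j)%:R)))) by ring.
      by rewrite ler_wpM2l ?(ltW k0)// -!expRD ler_expR.
    rewrite ler_wpM2r ?expR_ge0//; apply: ler_pM => //.
      by rewrite mulr_ge0 ?expR_ge0// ltW.
    by apply: le_trans Hj; rewrite ler_wpM2l// ltW.
  have [tt0|tt0] := leP t0 t.
    exists (n%:R * (t * x' - ln rho)); split; first exact: (lmgf_lb n_gt0 tt).
    have : t0 * (n%:R * ((x' - x) / 2)) <= t * (n%:R * ((x' - x) / 2)).
      by rewrite ler_wpM2r// mulr_ge0//; lra.
    have : t * (x * (kl j + kr j)%:R) <= t * (n%:R * ((x' - x) / 2)).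
      by rewrite ler_wpM2l//; lra.
    by rewrite TE; lra.
  exists 0; split; first by rewrite expR0 lmgf_ge1.
  have : t * x <= t0 * x by rewrite ler_wpM2r// ltW.
  have xT : x * (T j)%:R <= x * (2 * n%:R) by rewrite ler_wpM2l// TE; lra.
  have : t * (x * (T j)%:R) <= t * (x * (2 * n%:R)) by rewrite ler_wpM2l.
  have : n%:R * (t0 * x) <= n%:R * (ln rho / 4) by rewrite ler_wpM2l// ltW.
  have : n%:R * (t * x) <= n%:R * (t0 * x) by rewrite ler_wpM2l ?(ltW n0)// ler_wpM2r// ltW.
  by lra.
(* Supermultiplicativity along the multiples of [T j]. *)
exists (\prod_j T j)%N; first by rewrite prodn_gt0.
move=> t tt; have [j Hj] := key t tt.
have -> : (\prod_j T j)%N = ((\prod_(i | i != j) T i) * T j)%N by rewrite (bigD1 j)//= mulnC.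
set m := (\prod_(i | i != j) T i)%N.
have m0 : (0 < m)%N by rewrite prodn_gt0.
apply: le_trans (_ : (rho ^+ T j * gmgf (T j) t * expR (- (t * (x * (T j)%:R)))) ^+ m <= _).
  move: Hj; generalize (rho ^+ T j * gmgf (T j) t * expR (- (t * (x * (T j)%:R)))) => Z Z2.
  rewrite -(prednK m0) exprS; apply: le_trans (Z2) _.
  by apply: ler_peMr; [lra|apply: exprn_ege1; lra].
rewrite !exprMn -exprM -expRM_natr mulnC.
have -> : - (t * (x * (T j)%:R)) * m%:R = - (t * (x * (m * T j)%:R)) by rewrite natrM; ring.
rewrite ler_wpM2r ?expR_ge0// ler_wpM2l ?exprn_ge0 ?(ltW rho0)//.
exact: gmgf_pow.
Qed.

(** Apply [cramer_lower] to the law of the length of a good word of [N] steps,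
weighted by the mean number [rho ^ N] of descendants and recentered by
[x * N]: its convolution powers are dominated by the law of the length of a
good word of [m * N] steps, since concatenation adds the lengths. *)
Theorem good_block (eta : R) : 0 < eta -> exists2 b, (0 < b)%N &
  1 < rho ^+ b * walkE b (fun y => (good y && ((x - eta) * b%:R <= (len y)%:R))%R%:R) 1%g.
Proof.
move=> eta0; have [N N0 HN] := gmgf_large.
have NR : 0 < N%:R :> R by rewrite ltr0n.
pose M := (C * N).+1.
pose g (z : 'I_M) := rho ^+ N * walkE N (fun y => (good y && (len y == z))%:R) 1%g.
pose s (z : 'I_M) : R := z%:R - x * N%:R.
have g0 z : 0 <= g z by rewrite mulr_ge0 ?exprn_ge0 ?(ltW rho0)// walkE_ge0.
have Hg t : 0 <= t -> 2 <= \sum_z g z * expR (t * s z).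
  move=> tt; apply: le_trans (HN t tt) _.
  rewrite /gmgf mulrC -mulrCA -walkEZ.
  under [leRHS]eq_bigr => z _ do rewrite /g -mulrA [X in _ * X]mulrC -walkEZ.
  rewrite -big_distrr /= -walkE_sum ler_wpM2l ?exprn_ge0 ?(ltW rho0)//.
  apply: (le_walkE_ball p_ge0 len1 lenM lene) => y yl.
  have yM : (len y < M)%N by rewrite ltnS.
  rewrite (bigD1 (Ordinal yM))//= eqxx andbT.
  apply: ler_wpDr; first by apply: sumr_ge0 => z _; rewrite mulr_ge0 ?expR_ge0.
  rewrite mulrCA mulrC -expRD /s /= ler_wpM2r//.
  by rewrite ler_expR; lra.
have [m m0 Hm] := cramer_lower g0 (mulr_gt0 NR eta0) Hg.
have key f u : (forall v, 0 <= f v) -> convE g s m f u <=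
   rho ^+ (m * N) * walkE (m * N) (fun y => (good y)%:R *
      f (u + (len y)%:R - m%:R * (x * N%:R))) 1%g.
  move=> f0; elim: m u {m0 Hm} => [|m IH] u /=.
    by rewrite mul0n expr0 mul1r /= good1 len1 mul1r mul0r subr0 addr0.
  apply: le_trans (_ : \sum_(z : 'I_M) rho ^+ (m.+1 * N) * walkE N (fun y => (good y && (len y == z))%:R *
      walkE (m * N) (fun y => (good y)%:R *
      f (u + s z + (len y)%:R - m%:R * (x * N%:R))) 1%g) 1%g <= _).
    apply: ler_sum => z _; apply: le_trans (ler_wpM2l (g0 z) (IH _)) _.
    rewrite /g mulSn exprD.
    by rewrite walkEZr mulrACA.
  rewrite -big_distrr /= -walkE_sum ler_wpM2l ?exprn_ge0 ?(ltW rho0)//.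
  rewrite mulSn walkE_addn; apply: (le_walkE_ball p_ge0 len1 lenM lene) => y yl.
  have yM : (len y < M)%N by rewrite ltnS.
  rewrite (bigD1 (Ordinal yM))//= eqxx andbT big1 ?addr0; last first.
    move=> z zy; rewrite (_ : len y == z = false) ?andbF ?mul0r//.
    by apply: contra_neqF zy => /eqP zy; apply: val_inj.
  rewrite -[in leRHS](mulg1 y) walkE_shift -walkEZ; apply: le_walkE => // z.
  have [gy|_] := boolP (good y); last by rewrite mul0r mulr_ge0.
  have [gz|_] := boolP (good z); last by rewrite mul0r mulr0 mulr_ge0.
  have [-> ->] := good_mul gy gz; rewrite !mul1r le_eqVlt; apply/orP; left; apply/eqP.
  by congr f; rewrite /s /= natrD -natr1; ring.
exists (m * N)%N; first by rewrite muln_gt0 m0.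
apply: lt_le_trans Hm _; apply: le_trans (key _ _ _) _; first by [].
rewrite ler_wpM2l ?exprn_ge0 ?(ltW rho0)//; apply: le_walkE => // y.
case: (good y); rewrite ?mul0r// mul1r ler_nat.
case: leP => //= h; case: leP => //; move: h; rewrite natrM; lra.
Qed.

End GoodBlock.

(** * Survival in a branching functional *)
Section Branching.
Variables (R : realType) (A : finType) (p : A -> R) (K : nat) (q : 'I_K.+1 -> R).
Hypotheses (p_ge0 : forall a, 0 <= p a) (p_sum1 : \sum_a p a = 1).
Hypotheses (q_ge0 : forall k, 0 <= q k) (q_sum1 : \sum_k q k = 1).
Implicit Types (h : seq A -> R) (B W : pred (seq A)) (n b k : nat) (s u : R).

(** A configuration is a tree of depth [n] with at most [K] children per vertex and
with a step on each edge; offspring numbers are truncated at [K]. *)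
Fixpoint conf n : finType :=
  if n is n'.+1 then {k : 'I_K.+1 & {ffun 'I_k -> A * conf n'}} : finType else unit.

Fixpoint conf_weight n : conf n -> R :=
  if n is n'.+1 return conf n -> R then
    fun c : conf n'.+1 => q (tag c) * \prod_i (p (tagged c i).1 * conf_weight (tagged c i).2)
  else fun=> 1.

(** [B] is replaced by its left derivative along each edge, so that at depth 0 the
test is about the whole path from the root. *)
Fixpoint conf_fails n B : conf n -> bool :=
  if n is n'.+1 return conf n -> bool then
    fun c : conf n'.+1 =>
      [forall i, conf_fails (fun w => B ((tagged c i).1 :: w)) (tagged c i).2]
  else fun=> ~~ B [::].

Definition offspring_gf u : R := \sum_k q k * u ^+ k.
(** If each child succeeds independently with probability [s], then [survive s] is
the probability that some child succeeds. *)
Definition survive s : R := 1 - offspring_gf (1 - s).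

(** For [h] an indicator, the probability that some path of length [n] from the
root spells a word on which [h] is 1; allowing values in between lets the
success probability of the subtrees be plugged in as [h]. *)
Fixpoint surv n h : R :=
  if n is n'.+1 then survive (\sum_a p a * surv n' (fun w => h (a :: w))) else h [::].

(** The subtrees of the children are independent and identically distributed, so
the sum over configurations factorizes into a power, given the number of
children. *)
Lemma sum_conf_fails n B : \sum_(c : conf n | conf_fails B c) conf_weight c = 1 - surv n (fun w => (B w)%:R).
Proof.
elim: n B => [|n IH] B /=.
  rewrite big_mkcond /= (big_pred1 tt)//=.
  by case: (B [::]); rewrite /= ?subrr ?subr0.
rewrite /survive opprB addrCA subrr addr0.
pose Q (ac : A * conf n) := conf_fails (fun w => B (ac.1 :: w)) ac.2.
have IHQ : \sum_(ac | Q ac) p ac.1 * conf_weight ac.2 =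
    1 - \sum_a p a * surv n (fun w => (B (a :: w))%:R).
  rewrite -[X in _ = X - _]p_sum1 -sumrB (eq_bigl (fun ac => predT ac.1 && Q ac))//.
  rewrite -(pair_big_dep predT (fun a c => Q (a, c)) (fun a c => p a * conf_weight c)) /=.
  apply: eq_bigr => a _; rewrite -[X in X - _]mulr1 -mulrBr.
  by have /= <- := IH (fun w => B (a :: w)); rewrite big_distrr.
rewrite /offspring_gf -IHQ.
transitivity (\sum_(k < K.+1) \sum_(g : {ffun 'I_k -> A * conf n} | [forall i, Q (g i)])
    q k * \prod_i (p (g i).1 * conf_weight (g i).2)).
  by rewrite sig_big_dep.
apply: eq_bigr => k _; rewrite -big_distrr /=; congr (_ * _).
rewrite -[X in _ ^+ X](card_ord k) -prodr_const bigA_distr_big /=.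
by apply: eq_bigl => g; apply/forallP/ffun_onP.
Qed.

Lemma offspring_gf_ge0 u : 0 <= u -> 0 <= offspring_gf u.
Proof. by move=> u0; apply: sumr_ge0 => k _; rewrite mulr_ge0 ?exprn_ge0. Qed.

Lemma le_offspring_gf u v : 0 <= u -> u <= v -> offspring_gf u <= offspring_gf v.
Proof.
move=> u0 uv; apply: ler_sum => k _; rewrite ler_wpM2l//.
by rewrite lerXn2r ?nnegrE// (le_trans u0).
Qed.

Lemma offspring_gf1 : offspring_gf 1 = 1.
Proof. by rewrite /offspring_gf -[RHS]q_sum1; apply: eq_bigr => k _; rewrite expr1n mulr1. Qed.

Lemma le_survive s t : s <= t -> t <= 1 -> survive s <= survive t.
Proof. by move=> st t1; by rewrite lerD2l lerN2; apply: le_offspring_gf; rewrite ?subr_ge0 ?lerD2l ?lerN2. Qed.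

Lemma survive_le1 s : s <= 1 -> survive s <= 1.
Proof. by move=> s1; rewrite gerDl oppr_le0 offspring_gf_ge0// subr_ge0. Qed.

Lemma survive_ge0 s : 0 <= s -> s <= 1 -> 0 <= survive s.
Proof.
move=> s0 s1; rewrite subr_ge0 -[leRHS]offspring_gf1; by apply: le_offspring_gf; rewrite ?subr_ge0 ?gerBl.
Qed.

Definition offspring_mean : R := \sum_k q k * k%:R.

(** Termwise Bernoulli inequality. *)
Lemma survive_le_mean s : 0 <= s <= 1 -> survive s <= offspring_mean * s.
Proof.
move=> /andP[s0 s1]; rewrite /survive /offspring_gf -[X in X - _ <= _]q_sum1 -sumrB /offspring_mean big_distrl /=.
apply: ler_sum => k _; rewrite -{1}(mulr1 (q k)) -mulrBr -mulrA ler_wpM2l//.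
rewrite lerBlDl -lerBlDr; elim: (k : nat) => [|n IH]; first by rewrite mul0r subr0 expr0.
rewrite exprS -natr1.
have : (1 - s) * (1 - n%:R * s) <= (1 - s) * (1 - s) ^+ n by rewrite ler_wpM2l// subr_ge0.
have : 0 <= n%:R * s * s by rewrite !mulr_ge0.
lra.
Qed.

(** Second order lower bound, whose crude constant [K ^ 2] is harmless as [K] is
fixed. *)
Lemma survive_ge_quad s : 0 <= s <= 1 -> offspring_mean * s - K%:R ^+ 2 * s ^+ 2 <= survive s.
Proof.
move=> /andP[s0 s1].
have -> : K%:R ^+ 2 * s ^+ 2 = \sum_k q k * (K%:R ^+ 2 * s ^+ 2) :> R.
  by rewrite -big_distrl /= q_sum1 mul1r.
rewrite /survive /offspring_gf -[X in _ <= X - _]q_sum1 -sumrB /offspring_mean big_distrl /= -sumrB.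
apply: ler_sum => k _.
have -> : q k * k%:R * s - q k * (K%:R ^+ 2 * s ^+ 2) = q k * (k%:R * s - K%:R ^+ 2 * s ^+ 2) by ring.
rewrite -{2}(mulr1 (q k)) -mulrBr ler_wpM2l//.
have kK : k%:R ^+ 2 * s ^+ 2 <= K%:R ^+ 2 * s ^+ 2 :> R.
  by rewrite ler_wpM2r ?sqr_ge0// lerXn2r ?nnegrE// ler_nat -ltnS.
suff : (1 - s) ^+ k <= 1 - k%:R * s + k%:R ^+ 2 * s ^+ 2 by lra.
elim: (k : nat) => [|n IH]; first by rewrite expr0 expr0n !mul0r subr0 addr0.
rewrite exprS -natr1; apply: le_trans (ler_wpM2l _ IH) _; first by rewrite subr_ge0.
have n0 : 0 <= n%:R :> R by [].
have : 0 <= n%:R ^+ 2 * s ^+ 3 :> R by rewrite mulr_ge0 ?sqr_ge0 ?exprn_ge0.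
have : 0 <= (n%:R + 1) * s ^+ 2 :> R by rewrite mulr_ge0 ?sqr_ge0 ?addr_ge0.
lra.
Qed.

Lemma eq_surv n h h' : h =1 h' -> surv n h = surv n h'.
Proof.
elim: n h h' => [|n IH] h h' hh /=; first exact: hh.
congr survive; apply: eq_bigr => a _; congr (_ * _); exact: IH.
Qed.

Lemma sum_p_le1 (F : A -> R) : (forall a, F a <= 1) -> \sum_a p a * F a <= 1.
Proof.
move=> F1; rewrite -p_sum1; apply: ler_sum => a _.
by rewrite -[leRHS]mulr1 ler_wpM2l.
Qed.

Lemma surv_le1 n h : (forall w, h w <= 1) -> surv n h <= 1.
Proof.
elim: n h => [|n IH] h h1 //=.
apply: survive_le1; apply: sum_p_le1 => a; exact: IH.
Qed.

Lemma le_surv n h h' : (forall w, h w <= h' w) -> (forall w, h' w <= 1) ->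
  surv n h <= surv n h'.
Proof.
elim: n h h' => [|n IH] h h' hh h1 //=.
apply: le_survive; last by apply: sum_p_le1 => a; exact: surv_le1.
by apply: ler_sum => a _; rewrite ler_wpM2l// IH.
Qed.

(** Markov property at generation [n]. *)
Lemma surv_addn n m h :
  surv (n + m) h = surv n (fun w => surv m (fun v => h (w ++ v))).
Proof.
elim: n h => [|n IH] h //=; congr survive.
by apply: eq_bigr => a _; rewrite IH.
Qed.

(** The expectation of [h] over the path of a single random walk: the branching
recursion with exactly one child. *)
Fixpoint pathE n h : R :=
  if n is n'.+1 then \sum_a p a * pathE n' (fun w => h (a :: w)) else h [::].

Lemma pathE_ge0 n h : (forall w, 0 <= h w) -> 0 <= pathE n h.
Proof.
elim: n h => [|n IH] h h0 //=; apply: sumr_ge0 => a _.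
by rewrite mulr_ge0// IH.
Qed.

Lemma pathE_le n h (s : R) : (forall w, h w <= s) -> pathE n h <= s.
Proof.
elim: n h => [|n IH] h hs //=.
rewrite -[leRHS]mul1r -p_sum1 big_distrl /=; apply: ler_sum => a _.
by rewrite ler_wpM2l// IH.
Qed.

Lemma surv_ge0 n h : (forall w, 0 <= h w <= 1) -> 0 <= surv n h.
Proof.
elim: n h => [|n IH] h h01 /=; first by case/andP: (h01 [::]).
apply: survive_ge0.
  by apply: sumr_ge0 => a _; rewrite mulr_ge0// IH.
by apply: sum_p_le1 => a; apply: surv_le1 => w; case/andP: (h01 (a :: w)).
Qed.

Lemma offspring_mean_ge0 : 0 <= offspring_mean.
Proof. by apply: sumr_ge0 => k _; rewrite mulr_ge0. Qed.

(** First moment bound: the expected number of successful paths. *)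
Lemma surv_le n h : (forall w, 0 <= h w <= 1) -> surv n h <= offspring_mean ^+ n * pathE n h.
Proof.
elim: n h => [|n IH] h h01 /=; first by rewrite mul1r.
apply: le_trans (survive_le_mean _) _.
  apply/andP; split.
    by apply: sumr_ge0 => a _; rewrite mulr_ge0// surv_ge0.
  by apply: sum_p_le1 => a; apply: surv_le1 => w; case/andP: (h01 (a :: w)).
rewrite exprS -mulrA ler_wpM2l ?offspring_mean_ge0// big_distrr /=; apply: ler_sum => a _.
by rewrite mulrCA ler_wpM2l// IH.
Qed.

(** For a target value [s] small enough, the quadratic correction in
[survive_ge_quad] can be absorbed in replacing the mean by the smaller [m].
So over a block of length [b] the branching recursion maps [s] to at least
[m ^ b * s * P(W)], which is at least [s] if [m ^ b * P(W) >= 1]: the success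
probability of a chain of blocks is bounded below, whatever the number of
blocks. *)
Section Supercritical.
Variable m : R.
Hypotheses (m_ge0 : 0 <= m) (m_mean : m < offspring_mean) (mean1 : 1 <= offspring_mean) (K0 : (0 < K)%N).

Let s0 := (offspring_mean - m) / K%:R ^+ 2.

Let s0_gt0 : 0 < s0.
Proof. by rewrite divr_gt0 ?subr_gt0// exprn_gt0// ltr0n. Qed.

Lemma survive_ge s : 0 <= s -> s <= 1 -> s <= s0 -> m * s <= survive s.
Proof.
move=> s_ge0 s1 ss0; apply: le_trans (survive_ge_quad _); last by rewrite s_ge0.
have : K%:R ^+ 2 * s <= offspring_mean - m.
  by rewrite mulrC -ler_pdivlMr// exprn_gt0// ltr0n.
nra.
Qed.

(** The bound [offspring_mean ^+ b * s <= s0] keeps all the intermediate values in the range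
where [survive] is bounded below by a linear map. *)
Lemma surv_block b W s : 0 <= s -> s <= 1 -> offspring_mean ^+ b * s <= s0 ->
  m ^+ b * s * pathE b (fun w => (W w)%:R) <= surv b (fun w => s * (W w)%:R).
Proof.
move=> s_ge0 s1; elim: b W => [|b IH] W bs /=; first by rewrite !mul1r.
have h01 a w : 0 <= s * (W (a :: w))%:R <= 1.
  by case: (W _); rewrite ?mulr1 ?mulr0 ?lexx ?s_ge0 ?s1 ?ler01.
have bs' : offspring_mean ^+ b * s <= s0.
  by apply: le_trans bs; rewrite exprS -mulrA ler_peMl// mulr_ge0// exprn_ge0// offspring_mean_ge0.
have ss a : surv b (fun w => s * (W (a :: w))%:R) <= offspring_mean ^+ b * s.
  apply: le_trans (surv_le _ _) _; first exact: h01.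
  rewrite ler_wpM2l ?exprn_ge0 ?offspring_mean_ge0//; apply: pathE_le => w.
  by case: (W _); rewrite ?mulr1 ?mulr0.
apply: (le_trans _ (survive_ge _ _ _)).
- rewrite exprS -!mulrA ler_wpM2l// mulrA big_distrr /=; apply: ler_sum => a _.
  by rewrite mulrCA ler_wpM2l// IH.
- by apply: sumr_ge0 => a _; rewrite mulr_ge0// surv_ge0.
- by apply: sum_p_le1 => a; apply: surv_le1 => w; case/andP: (h01 a w).
- apply: le_trans bs'; rewrite -[leRHS]mul1r -[X in _ <= X * _]p_sum1 big_distrl /=; apply: ler_sum => a _.
  by rewrite ler_wpM2l// ss.
Qed.

Fixpoint chain W b j : pred (seq A) :=
  if j is j'.+1 then fun w => W (take b w) && chain W b j' (drop b w) else predT.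

Lemma eq_surv_size n h h' : (forall w, size w = n -> h w = h' w) -> surv n h = surv n h'.
Proof.
elim: n h h' => [|n IH] h h' hh /=; first exact: hh.
congr survive; apply: eq_bigr => a _; congr (_ * _); apply: IH => w wn; apply: hh.
by rewrite /= wn.
Qed.

Variables (W : pred (seq A)) (b : nat).
Hypothesis WB : 1 <= m ^+ b * pathE b (fun w => (W w)%:R).

Let s1 := Num.min 1 (s0 / offspring_mean ^+ b).

Let mb0 : 0 < offspring_mean ^+ b.
Proof. by rewrite exprn_gt0// (lt_le_trans _ mean1). Qed.

Let s1_gt0 : 0 < s1.
Proof. by rewrite lt_min ltr01 divr_gt0. Qed.

Lemma surv_chain j : s1 <= surv (j * b) (fun w => (chain W b j w)%:R).
Proof.
elim: j => [|j IH] /=; first by rewrite ge_min lexx.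
rewrite mulSn surv_addn; apply: le_trans (_ : surv b (fun w => s1 * (W w)%:R) <= _).
  apply: (le_trans _ (surv_block W (ltW s1_gt0) _ _)).
  - by rewrite -[leLHS]mul1r mulrAC ler_wpM2r// ltW.
  - by rewrite ge_min lexx.
  - by rewrite mulrC -ler_pdivlMr// ge_min lexx orbT.
rewrite [leRHS](@eq_surv_size b _
   (fun w => surv (j * b) (fun v => (W w && chain W b j v)%:R))); last first.
  move=> w wb; apply: eq_surv => v.
  by rewrite take_size_cat// drop_size_cat.
apply: le_surv => w; last by apply: surv_le1 => u; case: (_ && _).
case: (W w); rewrite /= ?mulr1// mulr0; apply: surv_ge0 => _; lra.
Qed.

Hypotheses (q0 : q ord0 = 0) (m1 : 1 <= m).

(** Without death, the generating function [f] of the offspring law satisfies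
[f u <= theta * u] for [u <= 1 - s1], where [1 - s1] bounds the failure
probability of one subtree.  Iterating [k] times bounds the probability that
all the subtrees of generation [k] fail.  Here [theta < 1] because the mean
exceeds 1, so that the number of children is not almost surely 1. *)
Lemma surv_restart : exists2 theta, 0 <= theta < 1 & forall k j,
  1 - surv (k + j * b) (fun w => (chain W b j (drop k w))%:R) <= theta ^+ k.
Proof.
have K1 : (1 < K.+1)%N by rewrite ltnS.
pose q1 := q (Ordinal K1).
have qE : offspring_gf =1 fun u => q1 * u + \sum_(k | (k != ord0) && (k != Ordinal K1)) q k * u ^+ k.
  move=> u; rewrite /offspring_gf (bigD1 ord0)//= q0 mul0r add0r.
  by rewrite (bigD1 (Ordinal K1))//= expr1.
set Q := fun k : 'I_K.+1 => (k != ord0) && (k != Ordinal K1).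
have Q2 (k : 'I_K.+1) : Q k -> (2 <= k)%N.
  by case: k => -[|[|k]] //= ? /andP[].
have rest : \sum_(k | Q k) q k = 1 - q1.
  have := qE 1; rewrite offspring_gf1 mulr1.
  under [X in _ = _ + X]eq_bigr do rewrite expr1n mulr1.
  rewrite -/Q; lra.
have q1_ge0 : 0 <= q1 := q_ge0 _.
have q1_lt1 : q1 < 1.
  rewrite lt_neqAle; apply/andP; split; last first.
    by rewrite -subr_ge0 -rest; apply: sumr_ge0 => k _.
  apply/eqP => q11.
  have : offspring_mean = 1; last by move: m1 m_mean; lra.
  rewrite /offspring_mean (bigD1 ord0)//= q0 mul0r add0r (bigD1 (Ordinal K1))//= -/q1 q11 mulr1.
  rewrite big1 ?addr0// => i Qi.
  have : q i <= \sum_(k | Q k) q k.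
    by rewrite (bigD1 i)//= lerDl sumr_ge0.
  rewrite rest q11 subrr => qk0.
  by have -> : q i = 0; [apply/le_anti; rewrite qk0 q_ge0|rewrite mul0r].
have s11 : s1 <= 1 by rewrite ge_min lexx.
have s1p := s1_gt0.
pose theta := q1 + (1 - q1) * (1 - s1).
have theta0 : 0 <= theta by rewrite addr_ge0// mulr_ge0; lra.
have theta1 : theta < 1.
  have : 0 < (1 - q1) * s1 by rewrite mulr_gt0//; lra.
  rewrite /theta; lra.
exists theta; first by rewrite theta0 theta1.
have ext u : 0 <= u -> u <= 1 - s1 -> offspring_gf u <= theta * u.
  move=> u0 u1; rewrite qE /theta mulrDl lerD2l -rest -mulrA big_distrl /=.
  apply: ler_sum => k /Q2 k2; rewrite ler_wpM2l//.
  rewrite -(subnKC k2) exprD expr2 mulrAC ler_wpM2r//.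
  rewrite -[leRHS]mulr1; apply: ler_pM => //; first exact: exprn_ge0.
  by apply: exprn_ile1 => //; lra.
have rec c k : s1 <= c -> c <= 1 -> 1 - surv k (fun=> c) <= theta ^+ k * (1 - s1).
  move=> c1 c2; elim: k => [|k IH] /=; first by rewrite mul1r lerD2l lerN2.
  rewrite -big_distrl /= p_sum1 mul1r /survive opprB addrCA subrr addr0.
  have c3 : surv k (fun=> c) <= 1 by exact: surv_le1.
  have tk : theta ^+ k <= 1 by apply: exprn_ile1; lra.
  apply: le_trans (ext _ _ _) _; first by rewrite subr_ge0.
    by apply: le_trans IH _; rewrite ler_piMl//; lra.
  by rewrite exprS -mulrA ler_wpM2l.
move=> k j.
rewrite surv_addn (@eq_surv_size k _ (fun=> surv (j * b) (fun w => (chain W b j w)%:R))).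
  apply: le_trans (rec _ _ (surv_chain j) _) _.
    by apply: surv_le1 => w; case: chain.
  by rewrite ler_piMr ?exprn_ge0//; lra.
by move=> w wk; apply: eq_surv => v; rewrite drop_size_cat.
Qed.

End Supercritical.

Section Walk.
Variables (G : groupType) (e : A -> G).

Lemma pathE_walkE n (f : G -> R) x :
  pathE n (fun w => f (x * \prod_(a <- w) e a)%g) = walkE e p n f x.
Proof.
elim: n x => [|n IH] x /=; first by rewrite big_nil mulg1.
apply: eq_bigr => a _; congr (_ * _); rewrite -IH.
by congr pathE; apply/funext => w; rewrite big_cons mulgA.
Qed.

End Walk.

End Branching.

(** * Laws of finitely many coordinates *)
Section FiniteEvents.
Context {R : realType} {d : measure_display} {T : measurableType d}.
Variable P : probability T R.

Lemma prob_fin (A : set T) : measurable A -> P A = (fine (P A))%:E.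
Proof. by move=> mA; rewrite fineK// fin_num_measure. Qed.

Lemma measure_disjoint_seq (I : eqType) (s : seq I) (F : I -> set T) : uniq s ->
  (forall i, measurable (F i)) -> (forall i j w, F i w -> F j w -> i = j) ->
  measurable [set w | exists2 i, i \in s & F i w] /\
  P [set w | exists2 i, i \in s & F i w] = (\sum_(i <- s) fine (P (F i)))%:E.
Proof.
move=> us mF dF; elim: s us => [|i s IH] /= us.
  rewrite big_nil (_ : [set w | _] = set0) ?measure0//.
  by apply/seteqP; split=> w // -[].
case/andP: us => nis /IH[mU PU].
have -> : [set w | exists2 j, j \in i :: s & F j w] =
    F i `|` [set w | exists2 j, j \in s & F j w].
  apply/seteqP; split=> w /=.
    by move=> [j]; rewrite in_cons => /orP[/eqP->|js] Fj; [left|right; exists j].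
  by move=> [Fi|[j js Fj]]; [exists i|exists j]; rewrite ?in_cons ?eqxx ?js ?orbT.
split; first exact: measurableU.
rewrite measureU//; last first.
  apply/seteqP; split=> w //= [Fi [j js Fj]].
  by move: nis; rewrite (dF _ _ _ Fi Fj) js.
by rewrite big_cons EFinD; congr (_ + _)%E; first exact: prob_fin.
Qed.

Lemma measure_finU (I : finType) (Q : pred I) (F : I -> set T) :
  (forall i, measurable (F i)) -> (forall i j w, F i w -> F j w -> i = j) ->
  measurable [set w | exists2 i, Q i & F i w] /\
  P [set w | exists2 i, Q i & F i w] = (\sum_(i | Q i) fine (P (F i)))%:E.
Proof.
move=> mF dF; have := measure_disjoint_seq (enum_uniq Q) mF dF.
rewrite (_ : [set w | _] = [set w | exists2 i, Q i & F i w]); last first.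
  by apply/seteqP; split=> w [i iQ Fi]; exists i => //; move: iQ; rewrite mem_enum.
by rewrite big_enum.
Qed.

End FiniteEvents.

Section ListEvents.
Context {R : realType} {d : measure_display} {T : measurableType d}.
Variable P : probability T R.

Definition all_eq (I V : eqType) (X : I -> T -> V) (L : seq (I * V)) : set T :=
  [set w | forall ix, ix \in L -> X ix.1 w = ix.2].

Lemma all_eq_nil (I V : eqType) (X : I -> T -> V) : all_eq X [::] = setT.
Proof. by apply/seteqP; split=> w // _ ix. Qed.

Lemma all_eq_cons (I V : eqType) (X : I -> T -> V) ix L :
  all_eq X (ix :: L) = X ix.1 @^-1` [set ix.2] `&` all_eq X L.
Proof.
apply/seteqP; split=> w /=.
  move=> H; split; first by apply: H; rewrite mem_head.
  by move=> jx jL; apply: H; rewrite in_cons jL orbT.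
by move=> [H1 H2] jx; rewrite in_cons => /orP[/eqP->//|]; exact: H2.
Qed.

Lemma measurable_all_eq (I V : eqType) (X : I -> T -> V) L :
  (forall i x, measurable (X i @^-1` [set x])) -> measurable (all_eq X L).
Proof.
move=> mX; elim: L => [|ix L IH]; first by rewrite all_eq_nil.
by rewrite all_eq_cons; exact: measurableI.
Qed.

(** An association list without repeated keys is the graph of a function; [v0] is its value elsewhere. *)
Lemma assocP (I V : eqType) (L : seq (I * V)) (v0 : V) : uniq (unzip1 L) ->
  exists x : I -> V, forall ix, ix \in L -> x ix.1 = ix.2.
Proof.
elim: L => [|[i v] L IH] /=; first by exists (fun=> v0).
case/andP => iL /IH[x Hx]; exists (fun j => if j == i then v else x j) => -[j u] /=.
rewrite in_cons => /orP[/eqP[-> ->]|jL]; first by rewrite eqxx.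
case: eqP => [ji|_]; last exact: (Hx (j, u)).
by move: iL; rewrite -ji => /negP; case; apply/mapP; exists (j, u).
Qed.

Lemma iid_all_eq (I V : eqType) (X : I -> T -> V) (p : V -> R) (v0 : V) L :
  iid_with_law P X p -> uniq (unzip1 L) ->
  P (all_eq X L) = (\prod_(ix <- L) p ix.2)%:E.
Proof.
move=> [mX H] uL; have [x Hx] := assocP v0 uL.
have := H (unzip1 L) x uL; rewrite big_map.
have -> : [set w | forall i, i \in unzip1 L -> X i w = x i] = all_eq X L.
  apply/seteqP; split=> w /= Hw.
    by move=> ix iL; rewrite -Hx//; apply: Hw; apply/mapP; exists ix.
  by move=> i /mapP[ix iL ->]; rewrite Hx//; exact: Hw.
by move=> ->; congr EFin; rewrite !big_seq; apply: eq_bigr => ix iL; rewrite Hx.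
Qed.

Section Truncation.
Variables (I : eqType) (N : I -> T -> nat) (off : nat -> R) (K : nat).
Hypothesis N_iid : iid_with_law P N off.

(** The law of [minn K (N i)]. *)
Definition trunc_law (k : nat) : R :=
  if (k < K)%N then off k else 1 - \sum_(j < K) off j.

Definition trunc i w := minn K (N i w).

Lemma measurable_N i (Q : pred nat) : measurable (N i @^-1` [set k | Q k]).
Proof.
rewrite (_ : _ @^-1` _ = \bigcup_(k in [set k | Q k]) (N i @^-1` [set k])).
  by apply: bigcup_measurable => k _; exact: N_iid.1.
apply/seteqP; split=> w /=; first by move=> Qw; exists (N i w).
by move=> [k /= Qk ->].
Qed.

Lemma split_tail (E : set T) i k : measurable E ->
  P E = (P (E `&` (N i @^-1` [set j | (k <= j)%N])) +
     (\sum_(j < k) fine (P (E `&` (N i @^-1` [set val j]))))%:E)%E.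
Proof.
move=> mE; elim: k => [|k IH].
  rewrite big_ord0 adde0; congr (P _).
  by apply/seteqP; split=> w //= [].
rewrite IH big_ord_recr /= EFinD -prob_fin; last by apply: measurableI => //; exact: N_iid.1.
rewrite addeA addeAC; congr (_ + _)%E.
rewrite addeC -measureU.
- congr (P _); apply/seteqP; split=> w /=.
    by move=> [Ew]; rewrite leq_eqVlt => /orP[/eqP kN|kN]; [left|right].
  by move=> [[Ew ->]|[Ew /ltnW]].
- by apply: measurableI => //; exact: N_iid.1.
- by apply: measurableI => //; exact: measurable_N.
- by apply/seteqP; split=> w //= [[_ ->] [_]]; rewrite ltnn.
Qed.

(** Only points have a prescribed probability under [iid_with_law], so the tail
event of a coordinate truncated at [K] is handled by removing the [K] points
below it; [L'] collects the coordinates that are already prescribed exactly. *)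
Lemma trunc_all_eq (L' L : seq (I * nat)) : uniq (unzip1 (L' ++ L)) ->
  all (fun ik => ik.2 <= K)%N L ->
  P (all_eq N L' `&` all_eq trunc L) =
  (\prod_(ix <- L') off ix.2 * \prod_(ix <- L) trunc_law ix.2)%:E.
Proof.
elim: L L' => [|[i k] L IH] L' uL /=.
  by rewrite all_eq_nil setIT big_nil mulr1 => _; rewrite (iid_all_eq 0%N N_iid)// -[L']cats0.
case/andP => kK aL.
have uL2 m : uniq (unzip1 (((i, m) :: L') ++ L)).
  by move: uL; rewrite /unzip1 !map_cat /= -[i :: map _ L]cat1s uniq_catCA.
have uL1 : uniq (unzip1 (L' ++ L)) by have /andP[] := uL2 0%N.
have mX j x : measurable (N j @^-1` [set x]) by exact: N_iid.1.
have mtr j x : measurable (trunc j @^-1` [set x]).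
  rewrite (_ : _ @^-1` _ = N j @^-1` [set k | minn K k == x]); first exact: measurable_N.
  by apply/seteqP; split=> w /= /eqP.
have cst m : P (all_eq N ((i, m) :: L') `&` all_eq trunc L) =
   (off m * (\prod_(ix <- L') off ix.2 * \prod_(ix <- L) trunc_law ix.2))%:E.
  by rewrite IH// big_cons mulrA.
have shift m : all_eq N ((i, m) :: L') `&` all_eq trunc L =
    (all_eq N L' `&` all_eq trunc L) `&` (N i @^-1` [set m]).
  by rewrite all_eq_cons /= -setIA setIC.
rewrite all_eq_cons setICA setIC big_cons /= /trunc_law.
have [kltK|Kk] := ltnP k K.
  have -> : trunc i @^-1` [set k] = N i @^-1` [set k].
    apply/seteqP; split=> w /=; rewrite /trunc; first by move: kltK; lia.
    by move=> ->; apply/minn_idPr/ltnW.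
  by rewrite -shift cst mulrCA.
have {Kk kK}-> : k = K by apply/eqP; rewrite eqn_leq kK.
have -> : trunc i @^-1` [set K] = N i @^-1` [set j | (K <= j)%N].
  apply/seteqP; split=> w /=; rewrite /trunc; last by move/minn_idPl.
  by move/minn_idPl.
have mE : measurable (all_eq N L' `&` all_eq trunc L).
  by apply: measurableI; exact: measurable_all_eq.
have := split_tail i K mE.
rewrite (IH L' uL1 aL).
rewrite (eq_bigr (fun j : 'I_K => off j * (\prod_(ix <- L') off ix.2 * \prod_(ix <- L) trunc_law ix.2)));
  last by move=> j _; rewrite -[X in fine (P X)](shift (val j)) cst.
rewrite -big_distrl /= prob_fin; last by apply: measurableI => //; exact: measurable_N.
rewrite -EFinD => H; have {H}[eqE] := H.
rewrite prob_fin; last by apply: measurableI => //; exact: measurable_N.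
rewrite mulrCA; congr EFin; move: eqE.
set Y := \prod_(ix <- L') _ * _; set X := fine _; set S := \sum_(j < K) off j.
by rewrite /=; lra.
Qed.

End Truncation.

End ListEvents.

(** * Probabilities of finite configurations *)
Lemma uniq_flatten_map (I U : eqType) (s : seq I) (f : I -> seq U) : uniq s ->
  (forall i, uniq (f i)) -> (forall i j x, x \in f i -> x \in f j -> i = j) ->
  uniq (flatten (map f s)).
Proof.
move=> us uf df; elim: s us => //= i s IH /andP[is_ /IH us].
rewrite cat_uniq uf us andbT; apply/hasPn => x /flatten_mapP[j js xj].
by apply/negP => xi; move: is_; rewrite (df _ _ _ xi xj) js.
Qed.

Lemma bigsetI_finP (T : Type) (J : finType) (F : J -> set T) w :
  (\big[setI/setT]_j F j) w <-> forall j, F j w.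
Proof.
suff H (s : seq J) : (\big[setI/setT]_(j <- s) F j) w <-> forall j, j \in s -> F j w.
  by rewrite H; split=> h j //; apply: h; rewrite mem_index_enum.
elim: s => [|i s IH]; first by rewrite big_nil.
rewrite big_cons; split=> [[Fi /IH H] j|H].
  by rewrite in_cons => /orP[/eqP->//|]; exact: H.
split; first by apply: H; rewrite mem_head.
by apply/IH => j js; apply: H; rewrite in_cons js orbT.
Qed.

Section BranchingEvents.
Context {R : realType} {d : measure_display} {T : measurableType d}.
Variable P : probability T R.
Variables (V : eqType) (N : seq nat -> T -> nat) (zeta : seq nat -> T -> V).
Variables (off : nat -> R) (law : V -> R).
Hypotheses (N_iid : iid_with_law P N off) (zeta_iid : iid_given_tree P N zeta law).
Variables (A : finType) (e : A -> V) (a0 : A).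
Hypothesis e_inj : injective e.
Local Notation p := (fun a => law (e a)).
Local Notation tree w := (in_tree (N^~ w)).

Let tree_sets := [set [set w | tree w v] | v in [set: seq nat]].

(** Steps can be prescribed independently of a tree event on which their vertices
are certainly in the tree. *)
Lemma zeta_all_eq (E : set T) (L : seq (seq nat * V)) : <<s tree_sets >> E ->
  uniq (unzip1 L) -> (forall w v, E w -> v \in unzip1 L -> tree w v) ->
  P (E `&` all_eq zeta L) = (P E * (\prod_(vx <- L) law vx.2)%:E)%E.
Proof.
move=> sE uL Etree; have [x Hx] := assocP (e a0) uL.
have := zeta_iid.2 E (unzip1 L) x sE uL; rewrite big_map.
rewrite (_ : E `&` [set w | forall v, v \in unzip1 L -> tree w v /\ zeta v w = x v] =
  E `&` all_eq zeta L); last first.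
  apply/seteqP; split=> w /= [Ew H]; split=> //.
    by move=> [v y] vL; rewrite -(Hx _ vL); apply: (H v _).2; apply/mapP; exists (v, y).
  move=> v vL; split; first exact: Etree vL.
  by move: vL => /mapP[ix iL ->]; rewrite Hx//; exact: H.
rewrite (_ : E `&` [set w | forall v, v \in unzip1 L -> tree w v] = E); last first.
  by apply/seteqP; split=> w /= => [[]//|Ew]; split=> // v; exact: Etree.
by move=> ->; congr (_ * EFin _)%E; rewrite !big_seq; apply: eq_bigr => ix iL; rewrite Hx.
Qed.

Section Truncated.
Variable K : nat.
Local Notation conf := (conf A K).
Local Notation q := (fun k : 'I_K.+1 => trunc_law off K k).
Local Notation trunc := (trunc N K).
Local Notation conf_weight := (conf_weight p q).

Fixpoint conf_offspring n (v : seq nat) : conf n -> seq (seq nat * nat) :=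
  if n is n'.+1 return conf n -> seq (seq nat * nat) then fun c : conf n'.+1 =>
    (v, val (tag c)) ::
    flatten [seq conf_offspring (rcons v (val i)) (tagged c i).2 | i <- enum 'I_(tag c)]
  else fun=> [::].

Fixpoint conf_steps n (v : seq nat) : conf n -> seq (seq nat * V) :=
  if n is n'.+1 return conf n -> seq (seq nat * V) then fun c : conf n'.+1 =>
    flatten [seq (rcons v (val i), e (tagged c i).1) ::
                 conf_steps (rcons v (val i)) (tagged c i).2 | i <- enum 'I_(tag c)]
  else fun=> [::].

Definition conf_event n v (c : conf n) : set T :=
  all_eq trunc (conf_offspring v c) `&` all_eq zeta (conf_steps v c).

Lemma measurable_trunc v k : measurable (trunc v @^-1` [set k]).
Proof.
rewrite (_ : _ @^-1` _ = N v @^-1` [set j | minn K j == k]); first exact: measurable_N N_iid _ _.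
by apply/seteqP; split=> w /= /eqP.
Qed.

Lemma measurable_conf_event n v (c : conf n) : measurable (conf_event v c).
Proof.
apply: measurableI; first by apply: measurable_all_eq; exact: measurable_trunc.
by apply: measurable_all_eq; exact: zeta_iid.1.
Qed.

Lemma all_eq_flatten (I : eqType) (W : eqType) (X : I -> T -> W) (J : finType) (f : J -> seq (I * W)) w :
  all_eq X (flatten [seq f j | j <- enum J]) w <-> forall j, all_eq X (f j) w.
Proof.
split=> [H j ix iL|H ix /flatten_mapP[j _ jL]]; last exact: (H j).
by apply: H; apply/flatten_mapP; exists j; rewrite ?mem_enum.
Qed.

Lemma conf_eventS n v (c : conf n.+1) w : conf_event v c w <->
  trunc v w = tag c /\ forall i : 'I_(tag c),
    zeta (rcons v i) w = e (tagged c i).1 /\ conf_event (rcons v i) (tagged c i).2 w.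
Proof.
rewrite /conf_event /=; split=> [[H1 H2]|[H1 H2]].
  move: H1; rewrite all_eq_cons => -[H1 /all_eq_flatten H3]; split=> // i.
  move: H2 => /all_eq_flatten/(_ i); rewrite all_eq_cons => -[H2 H4].
  by split.
split.
  rewrite all_eq_cons; split=> //; apply/all_eq_flatten => i.
  by have [_ []] := H2 i.
apply/all_eq_flatten => i; rewrite all_eq_cons; have [H3 [_ H4]] := H2 i.
by split.
Qed.

(** A realization determines its configuration because [e] is injective: different
configurations describe disjoint events. *)
Lemma conf_event_inj n v (c c' : conf n) w : conf_event v c w -> conf_event v c' w -> c = c'.
Proof.
elim: n v c c' => [|n IH] v c c'; first by case: c c' => -[].
case: c c' => k g [k' g'] /conf_eventS[/= k1 H] /conf_eventS[/= k2 H'].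
have kk : k = k' by apply: val_inj; rewrite /= -k1 -k2.
case: _ / kk g' H' {k1 k2} => g' H'; congr existT; apply/ffunP => i.
have [a1 c1] := H i; have [a2 c2] := H' i.
rewrite [g i]surjective_pairing [g' i]surjective_pairing.
by congr pair; [apply: e_inj; rewrite -a1 -a2|exact: IH c1 c2].
Qed.

Lemma conf_offspring_le n v (c : conf n) : all (fun ik => ik.2 <= K)%N (conf_offspring v c).
Proof.
elim: n v c => [|n IH] v c //=; rewrite -ltnS ltn_ord /=.
by apply/allP => x /flatten_mapP[i _]; apply: (allP (IH _ _)).
Qed.

Lemma rcons_prefix_inj (v u : seq nat) i j : prefix (rcons v i) u -> prefix (rcons v j) u -> i = j.
Proof.
move=> /prefixP[s ->] /prefixP[s']; rewrite !cat_rcons => /eqP.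
by rewrite eqseq_cat// eqxx /= => /eqP[].
Qed.

Lemma conf_offspring_prefix n v (c : conf n) u : u \in unzip1 (conf_offspring v c) -> prefix v u.
Proof.
elim: n v c => [|n IH] v c //=; rewrite in_cons => /orP[/eqP->|]; first exact: prefix_refl.
rewrite /unzip1 map_flatten -map_comp => /flatten_mapP[i _ /IH].
by apply: prefix_trans; exact: prefix_rcons.
Qed.

Lemma conf_steps_prefix n v (c : conf n) u : u \in unzip1 (conf_steps v c) ->
  prefix v u /\ (size v < size u)%N.
Proof.
elim: n v c => [|n IH] v c //=.
rewrite /unzip1 map_flatten -map_comp => /flatten_mapP[i _] /=.
rewrite in_cons => /orP[/eqP->|/IH[]]; first by rewrite prefix_rcons size_rcons.
rewrite size_rcons => h1 h2; split; last by apply: ltn_trans h2.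
exact: prefix_trans (prefix_rcons _ _) h1.
Qed.

Lemma uniq_conf_offspring n v (c : conf n) : uniq (unzip1 (conf_offspring v c)).
Proof.
elim: n v c => [|n IH] v c //=; apply/andP; split.
  apply/negP; rewrite /unzip1 map_flatten -map_comp => /flatten_mapP[i _].
  move=> /conf_offspring_prefix/prefixP[s /(congr1 size)].
  by rewrite size_cat size_rcons; lia.
rewrite /unzip1 map_flatten -map_comp; apply: uniq_flatten_map; first exact: enum_uniq.
  by move=> i /=; exact: IH.
move=> i j x /= /conf_offspring_prefix xi /conf_offspring_prefix xj.
exact/val_inj/(rcons_prefix_inj xi xj).
Qed.

Lemma uniq_conf_steps n v (c : conf n) : uniq (unzip1 (conf_steps v c)).
Proof.
elim: n v c => [|n IH] v c //=.
rewrite /unzip1 map_flatten -map_comp; apply: uniq_flatten_map; first exact: enum_uniq.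
  move=> i /=; rewrite IH andbT; apply/negP => /conf_steps_prefix[_].
  by rewrite ltnn.
move=> i j x /=; rewrite !in_cons => xi xj; apply/val_inj.
have h (k : 'I_(tag c)) : (x == rcons v k) || (x \in [seq y.1 | y <- conf_steps (rcons v k) (tagged c k).2]) ->
    prefix (rcons v k) x.
  by move=> /orP[/eqP->|/conf_steps_prefix[]//]; exact: prefix_refl.
exact: rcons_prefix_inj (h i xi) (h j xj).
Qed.

Lemma prod_conf n v (c : conf n) :
  \prod_(ik <- conf_offspring v c) trunc_law off K ik.2 *
  \prod_(vx <- conf_steps v c) law vx.2 = conf_weight c.
Proof.
elim: n v c => [|n IH] v c /=; first by rewrite !big_nil mulr1.
rewrite big_cons !big_flatten !big_map -mulrA -big_split /=; congr (_ * _).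
rewrite -enumT big_enum /=; apply: eq_bigr => i _.
by rewrite big_cons /= mulrCA IH.
Qed.

Lemma conf_steps_in_tree n v (c : conf n) w u : tree w v ->
  all_eq trunc (conf_offspring v c) w -> u \in unzip1 (conf_steps v c) -> tree w u.
Proof.
elim: n v c => [|n IH] v c //= tv.
rewrite all_eq_cons => -[/= kN /all_eq_flatten H].
rewrite /unzip1 map_flatten -map_comp => /flatten_mapP[i _] /=.
have ti : tree w (rcons v i).
  by rewrite in_tree_rcons tv /=; have := ltn_ord i; move: kN; rewrite /trunc; lia.
by rewrite in_cons => /orP[/eqP->//|]; exact: IH ti (H i).
Qed.

(** For a vertex [v] of the tree, its truncated offspring number is read off from
which labels [rcons v i] belong to the tree. *)
Lemma conf_offspring_sigma n v (c : conf n) :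
  <<s tree_sets >> ([set w | tree w v] `&` all_eq trunc (conf_offspring v c)).
Proof.
have mt u : (@measurable _ (g_sigma_algebraType tree_sets)) [set w | tree w u].
  by apply: sub_gen_smallest; exists u.
suff : (@measurable _ (g_sigma_algebraType tree_sets))
  ([set w | tree w v] `&` all_eq trunc (conf_offspring v c)) by [].
elim: n v c => [|n IH] v c; first by rewrite /= all_eq_nil setIT.
pose B1 := [set w | tree w v] `&`
  (\big[setI/setT]_(i : 'I_(tag c)) [set w | tree w (rcons v i)]) `&`
  (if (tag c < K)%N then ~` [set w | tree w (rcons v (tag c))] else setT).
pose B2 := \big[setI/setT]_(i : 'I_(tag c)) ([set w | tree w (rcons v i)] `&`
   all_eq trunc (conf_offspring (rcons v i) (tagged c i).2)).
have -> : [set w | tree w v] `&` all_eq trunc (conf_offspring v c) = B1 `&` B2.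
  apply/seteqP; split=> w /=; rewrite all_eq_cons.
    move=> [tv [/= kN0 /all_eq_flatten H]].
    have kN : minn K (N v w) = nat_of_ord (tag c) := kN0.
    have ti (i : 'I_(tag c)) : tree w (rcons v i).
      by rewrite in_tree_rcons tv /=; apply: leq_trans (ltn_ord i) _; rewrite -kN geq_minr.
    split; last by apply/bigsetI_finP => i; split=> //=; exact: ti.
    split; first by split=> //; apply/bigsetI_finP.
    case: ifP => // kK /=; rewrite in_tree_rcons tv /=; apply/negP; rewrite -leqNgt.
    move: kK; rewrite -kN gtn_min ltnn /= => /ltnW NK.
    by rewrite leq_min NK leqnn.
  move=> [[[tv /bigsetI_finP ti] tk] /bigsetI_finP H]; split=> //; split; last first.
    by apply/all_eq_flatten => i; have [] := H i.
  rewrite /= /trunc.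
  (* The last prescribed child is in the tree. *)
  have kN : (tag c <= N v w)%N.
    case: (posnP (tag c)) => [->//|k0].
    have k1 : ((tag c).-1 < tag c)%N by rewrite prednK.
    by have := ti (Ordinal k1); rewrite /= in_tree_rcons => /andP[_] /=; rewrite prednK.
  move: tk; case: ltnP => [kK|Kk] tk; last first.
    have -> : val (tag c) = K by apply/eqP; rewrite eqn_leq Kk -ltnS ltn_ord.
    by apply/minn_idPl; exact: leq_trans kN.
  have : ~~ tree w (rcons v (tag c)) by apply/negP.
  rewrite in_tree_rcons tv /= -leqNgt => Nk.
  have NE : N v w = tag c by apply/eqP; rewrite eqn_leq Nk.
  by rewrite NE; apply/minn_idPr/ltnW.
apply: measurableI; first apply: measurableI; first apply: measurableI => //.
- by apply: bigsetI_measurable => i _.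
- by case: ifP => _; [exact: measurableC|exact: measurableT].
- by apply: bigsetI_measurable => i _; exact: IH.
Qed.

(** The offspring numbers are independent and the steps are independent given the
tree. *)
Lemma prob_conf n (c : conf n) : P (conf_event [::] c) = (conf_weight c)%:E.
Proof.
have sE : <<s tree_sets >> (all_eq trunc (conf_offspring [::] c)).
  have := conf_offspring_sigma [::] c; rewrite (_ : [set w | _] = setT) ?setTI//.
  by apply/seteqP; split.
rewrite /conf_event (zeta_all_eq sE (uniq_conf_steps [::] c)); last first.
  by move=> w u H; apply: conf_steps_in_tree H.
have := trunc_all_eq (K := K) N_iid (L' := [::]) (uniq_conf_offspring [::] c) (conf_offspring_le _ _).
by rewrite all_eq_nil setTI big_nil mul1r => ->; rewrite -EFinM prod_conf.
Qed.

End Truncated.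
End BranchingEvents.

(** * Paths in the branching random walk *)
Lemma in_tree_cat N v s : in_tree N (v ++ s) -> in_tree N v.
Proof.
elim/last_ind: s => [|s i IH]; first by rewrite cats0.
by rewrite -rcons_cat in_tree_rcons => /andP[/IH].
Qed.

Section PathSteps.
Variables (T : Type) (V : Type) (zeta : seq nat -> T -> V) (w : T).

(** The steps met on the way from [v] down to [v ++ s]. *)
Fixpoint path_steps (v s : seq nat) : seq V :=
  if s is i :: s' then zeta (rcons v i) w :: path_steps (rcons v i) s' else [::].

End PathSteps.

Lemma brw_path_steps (T : Type) (G : groupType) (zeta : seq nat -> T -> G) s w :
  (\prod_(1 <= k < (size s).+1) zeta (take k s) w)%g = (\prod_(x <- path_steps zeta w [::] s) x)%g.
Proof.
suff H v : (\prod_(x <- path_steps zeta w v s) x =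
    \prod_(1 <= k < (size s).+1) zeta (v ++ take k s) w)%g by rewrite H.
elim: s v => [|i s IH] v /=; first by rewrite big_nil big_geq.
rewrite big_cons IH [RHS]big_ltn//= take0 cats1; congr (_ * _)%g.
rewrite [RHS]big_add1 /=; apply: eq_big_nat => k _.
by rewrite cat_rcons.
Qed.

Section OffspringLaw.
Variables (R : realType) (off : nat -> R) (rho : R).
Hypothesis off_ge0 : forall k, 0 <= off k.
Hypothesis off_sum1 : (\sum_(0 <= k <oo) (off k)%:E = 1)%E.
Hypothesis off_mean : (\sum_(0 <= k <oo) (k%:R * off k)%:E = rho%:E)%E.

Lemma partial_sum_le (f : nat -> R) (l : R) : (forall k, 0 <= f k) ->
  (\sum_(0 <= k <oo) (f k)%:E = l%:E)%E ->
  (forall K, \sum_(k < K) f k <= l) /\ forall l', l' < l -> exists K0, forall K, (K0 <= K)%N -> l' < \sum_(k < K) f k.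
Proof.
move=> f0 fl; have up K : \sum_(k < K) f k <= l.
  rewrite -lee_fin -fl -sumEFin -(big_mkord xpredT (fun k => (f k)%:E)).
  by apply: nneseries_lim_ge => k _ _; rewrite lee_fin.
split=> // l' l'l.
have [K0 H0] : exists K0, l' < \sum_(k < K0) f k.
  apply/not_existsP => H; move: l'l; apply/negP; rewrite -leNgt -lee_fin -fl.
  apply: lime_le; first by apply: is_cvg_nneseries => k _ _; rewrite lee_fin.
  apply: nearW => K; rewrite big_mkord sumEFin lee_fin leNgt; apply/negP/H.
exists K0 => K K0K; apply: lt_le_trans H0 _.
rewrite -(subnKC K0K) big_split_ord /= lerDl; exact: sumr_ge0.
Qed.

Section Trunc.
Variable K : nat.
Let q (k : 'I_K.+1) := trunc_law off K k.

Lemma trunc_law_ge0 k : 0 <= trunc_law off K k.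
Proof.
rewrite /trunc_law; case: ifP => // _.
by rewrite subr_ge0 (partial_sum_le off_ge0 off_sum1).1.
Qed.

Lemma trunc_law_sum1 : \sum_k q k = 1.
Proof.
rewrite big_ord_recr /=.
have -> : \sum_(k < K) q (widen_ord (leqnSn K) k) = \sum_(k < K) off k.
  by apply: eq_bigr => k _; rewrite /q /trunc_law /= ltn_ord.
by rewrite /q /trunc_law /= ltnn addrC subrK.
Qed.

Lemma trunc_meanE : offspring_mean q = \sum_(k < K) k%:R * off k + K%:R * (1 - \sum_(k < K) off k).
Proof.
rewrite /offspring_mean big_ord_recr /= {2}/q /trunc_law /= ltnn [X in _ + X]mulrC; congr (_ + _).
by apply: eq_bigr => k _; rewrite /q /trunc_law /= ltn_ord mulrC.
Qed.

(** Each unit of mass beyond [K] counts for [K] in the truncated mean and for at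
least [K] in the mean. *)
Lemma trunc_mean_le : offspring_mean q <= rho.
Proof.
rewrite trunc_meanE leNgt; apply/negP.
set S1 := \sum_(k < K) _; set S0 := \sum_(k < K) _ => H.
pose gap := S1 + K%:R * (1 - S0) - rho.
have g0 : 0 < gap by rewrite subr_gt0.
have K0 : 0 <= K%:R :> R by [].
have e0 : 0 < gap / (K%:R + 1) by rewrite divr_gt0//; lra.
have [M0 HM] := (partial_sum_le off_ge0 off_sum1).2 (1 - gap / (K%:R + 1)) ltac:(lra).
have {}HM := HM (M0 + K)%N (leq_addr _ _).
have f0 k : 0 <= k%:R * off k by rewrite mulr_ge0.
have up := (partial_sum_le f0 off_mean).1 (K + M0)%N.
have key M : S1 + K%:R * (\sum_(k < K + M) off k - S0) <= \sum_(k < K + M) k%:R * off k.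
  rewrite !big_split_ord /= -/S0 -/S1 addrAC subrr add0r lerD2l big_distrr /=.
  by apply: ler_sum => k _; rewrite ler_wpM2r// ler_nat leq_addr.
have := key M0; rewrite [(M0 + K)%N]addnC in HM.
have : K%:R * (gap / (K%:R + 1)) < gap by rewrite mulrCA gtr_pMr// ltr_pdivrMr; lra.
have : K%:R * (1 - gap / (K%:R + 1)) <= K%:R * (\sum_(k < K + M0) off k) by rewrite ler_wpM2l// ltW.
move: up; rewrite /gap; set X := \sum_(k < K + M0) k%:R * off k; set Y := \sum_(k < K + M0) off k.
set Z := _ / (K%:R + 1).
lra.
Qed.

End Trunc.

Lemma trunc_mean_cvg m : m < rho -> exists K0, forall K, (K0 <= K)%N ->
  m < offspring_mean (fun k : 'I_K.+1 => trunc_law off K k).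
Proof.
have f0 k : 0 <= k%:R * off k by rewrite mulr_ge0.
move=> /(partial_sum_le f0 off_mean).2[K0 H]; exists K0 => K /H h.
rewrite trunc_meanE; apply: lt_le_trans h _; rewrite lerDl mulr_ge0//.
by rewrite subr_ge0 (partial_sum_le off_ge0 off_sum1).1.
Qed.

End OffspringLaw.

Section HitEvents.
Context {R : realType} {d : measure_display} {T : measurableType d}.
Variable P : probability T R.
Variables (V : eqType) (N : seq nat -> T -> nat) (zeta : seq nat -> T -> V).
Variables (off : nat -> R) (law : V -> R).
Hypotheses (N_iid : iid_with_law P N off) (zeta_iid : iid_given_tree P N zeta law).
Variables (A : finType) (e : A -> V) (a0 : A).
Hypothesis e_inj : injective e.
Hypotheses (law_ge0 : forall a, 0 <= law (e a)) (law_sum1 : \sum_a law (e a) = 1).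
Variable rho : R.
Hypothesis off_ge0 : forall k, 0 <= off k.
Hypothesis off_sum1 : (\sum_(0 <= k <oo) (off k)%:E = 1)%E.
Hypothesis off_mean : (\sum_(0 <= k <oo) (k%:R * off k)%:E = rho%:E)%E.
Local Notation p := (fun a => law (e a)).
Local Notation tree w := (in_tree (N^~ w)).

Section Trunc.
Variable K : nat.
Local Notation conf := (conf A K).
Local Notation q := (fun k : 'I_K.+1 => trunc_law off K k).
Local Notation conf_event := (conf_event N zeta e).

Lemma conf_hit n v (c : conf n) B w : tree w v -> conf_event v c w -> ~~ conf_fails B c ->
  exists s a, [/\ size s = n, B a, tree w (v ++ s) & path_steps zeta w v s = map e a].
Proof.
elim: n v c B => [|n IH] v c B tv /=.
  by rewrite negbK => _ B0; exists [::], [::]; rewrite cats0.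
move=> /conf_eventS[kN H] /forallPn[i].
have [zi ci] := H i.
have ti : tree w (rcons v i).
  rewrite in_tree_rcons tv /=; apply: leq_trans (ltn_ord i) _.
  have kN' : minn K (N v w) = nat_of_ord (tag c) := kN.
  by rewrite -kN' geq_minr.
move=> /(IH _ _ _ ti ci)[s [a [sn Ba ts sa]]].
exists (val i :: s), ((tagged c i).1 :: a); rewrite /= sn; split=> //.
  by rewrite -cat_rcons.
by rewrite zi sa.
Qed.

(** Labels below [K] are the ones that the configuration sees. *)
Lemma conf_miss n v (c : conf n) B w s : conf_event v c w -> conf_fails B c ->
  size s = n -> all (fun i => i < K)%N s -> tree w (v ++ s) ->
  exists2 a, path_steps zeta w v s = map e a & ~~ B a.
Proof.
elim: n v c B s => [|n IH] v c B s /=.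
  by move=> _ B0 /size0nil -> _ _; exists [::].
move=> /conf_eventS[kN H] /forallP Hf; case: s => [//|j s] [sn] /= /andP[jK sK].
rewrite -cat_rcons => ts.
have jk : (j < tag c)%N.
  have := in_tree_cat ts; rewrite in_tree_rcons => /andP[_ jN].
  have kN' : minn K (N v w) = nat_of_ord (tag c) := kN.
  by rewrite -kN' leq_min jK.
have [zi ci] := H (Ordinal jk).
have [a sa Ba] := IH _ _ _ _ ci (Hf (Ordinal jk)) sn sK ts.
by exists ((tagged c (Ordinal jk)).1 :: a) => //=; rewrite zi sa.
Qed.

(** The weights of all the configurations add up to 1, so both the failing and
the successful ones have the expected probability. *)
Lemma prob_hit n B (b : bool) :
  let U := [set w | exists2 c : conf n, conf_fails B c == b & conf_event [::] c w] in
  measurable U /\ P U = (if b then 1 - surv p q n (fun w => (B w)%:R)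
                        else surv p q n (fun w => (B w)%:R))%:E.
Proof.
have [|mU PU] := measure_finU P (fun c : conf n => conf_fails B c == b)
  (measurable_conf_event N_iid zeta_iid e [::]).
  by move=> i j w; exact: conf_event_inj.
split=> //; rewrite PU; congr EFin.
have wE (c : conf n) : fine (P (conf_event [::] c)) = conf_weight p q c.
  by rewrite (prob_conf N_iid zeta_iid e a0).
transitivity (\sum_(c : conf n | conf_fails B c == b) conf_weight p q c).
  by apply: eq_bigr => c _; exact: wE.
have q1 := trunc_law_sum1 off K.
have F : \sum_(c : conf n | conf_fails B c) conf_weight p q c = 1 - surv p q n (fun w => (B w)%:R).
  by apply: sum_conf_fails.
case: b {mU PU} => /=; first by rewrite -F; apply: eq_bigl => c; case: conf_fails.
have tot : \sum_(c : conf n) conf_weight p q c = 1.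
  have := @sum_conf_fails R A p K q law_sum1 n xpred0.
  have -> : \sum_(c : conf n | conf_fails xpred0 c) conf_weight p q c = \sum_(c : conf n) conf_weight p q c.
    apply: eq_bigl => c; elim: n c {wE F} => [|n IH] c //=.
    by apply/forallP => i; exact: IH.
  move=> ->; suff -> : surv p q n (fun=> 0) = 0 by rewrite subr0.
  elim: n {wE F} => //= n IH; rewrite IH.
  rewrite big1 => [|a _]; last by rewrite mulr0.
  by rewrite /survive /offspring_gf subr0 -{1}q1 -sumrB big1// => k _; rewrite expr1n mulr1 subrr.
rewrite (eq_bigl (fun c => ~~ conf_fails B c)); last by move=> c; rewrite eqbF_neg.
by move: tot; rewrite (bigID (conf_fails B)) /= F; lra.
Qed.

End Trunc.

(** First moment bound for the whole tree.  Given a vertex, all truncation levels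
above its labels see it, so the event is the increasing limit over [K0] of the
events seen by all the truncation levels [K > K0]. *)
Lemma hit_upper n (B : pred (seq A)) : exists2 U : set T, measurable U &
  (P U <= (rho ^+ n * pathE p n (fun w => (B w)%:R))%:E)%E /\
  forall w, ~ U w -> forall s, size s = n -> tree w s ->
    exists2 a, path_steps zeta w [::] s = map e a & ~~ B a.
Proof.
pose F K := [set w | exists2 c : conf A K n, conf_fails B c == true & conf_event N zeta e [::] c w].
have mF K : measurable (F K) by have [] := prob_hit K n B true.
pose U := \bigcup_K0 \bigcap_(K in [set K | (K0 < K)%N]) (~` F K).
have mG K0 : measurable (\bigcap_(K in [set K | (K0 < K)%N]) (~` F K)).
  by apply: bigcap_measurable; [exists K0.+1 => /=|move=> K _; exact: measurableC].
exists U; first exact: bigcup_measurable.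
split.
  have nd : {homo (fun K0 => \bigcap_(K in [set K | (K0 < K)%N]) (~` F K)) : n m / (n <= m)%N >-> (n <= m)%O}.
    move=> i j ij; apply/subsetPset => w Hw K /= jK; apply: Hw => /=.
    exact: leq_ltn_trans jK.
  have cv := nondecreasing_cvg_mu (mu := P) mG (bigcup_measurable (fun k _ => mG k)) nd.
  apply: (@cvge_le _ _ _ _ _ _ _ _ cv); apply: nearW => K0 /=.
  apply: (@le_trans _ _ (P (~` F K0.+1))).
    apply: le_measure; rewrite ?inE//; first exact: measurableC.
    by move=> w; apply => /=.
  rewrite probability_setC//; have [_ ->] := prob_hit K0.+1 n B true.
  rewrite -EFinB lee_fin opprB addrCA subrr addr0.
  have q0 := trunc_law_ge0 off_ge0 off_sum1 K0.+1.
  have h01 w : 0 <= ((B w)%:R : R) <= 1 by case: (B w); rewrite ?lexx ler01.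
  have h0 w : 0 <= (B w)%:R :> R by [].
  apply: le_trans (surv_le law_ge0 law_sum1 (fun k => q0 k) (trunc_law_sum1 off _) n h01) _.
  apply: ler_wpM2r; first exact: pathE_ge0.
  have m0 : 0 <= offspring_mean (fun k : 'I_K0.+2 => trunc_law off K0.+1 k).
    by apply: offspring_mean_ge0 => k; exact: q0.
  have mr : offspring_mean (fun k : 'I_K0.+2 => trunc_law off K0.+1 k) <= rho by exact: trunc_mean_le.
  by apply: lerXn2r => //; rewrite nnegrE// (le_trans m0).
move=> w nU s sn ts.
pose K0 := \max_(i <- s) i.
have [K [K0K FK]] : exists K, (K0 < K)%N /\ F K w.
  apply: contra_notP nU => H; exists K0 => // K /= K0K FK.
  by apply: H; exists K.
have sK : all (fun i => i < K)%N s.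
  apply/allP => i iS; apply: leq_ltn_trans K0K.
  by rewrite /K0 (big_rem i)//= leq_maxl.
case: FK => c /eqP cf ce.
exact: (conf_miss ce cf sn sK ts).
Qed.

Lemma hit_lower K n (B : pred (seq A)) : exists U : set T,
  [/\ measurable U,
      P U = (1 - surv p (fun k : 'I_K.+1 => trunc_law off K k) n (fun w => (B w)%:R))%:E &
      forall w, ~ U w -> exists s a,
        [/\ size s = n, B a, tree w s & path_steps zeta w [::] s = map e a]].
Proof.
have [/= mU PU] := prob_hit K n B false.
exists (~` [set w | exists2 c : conf A K n, conf_fails B c == false & conf_event N zeta e [::] c w]).
split; first exact: measurableC.
  by rewrite probability_setC// PU.
move=> w /contrapT[c]; rewrite eqbF_neg => nc ce.
by have := conf_hit _ ce nc; exact.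
Qed.

End HitEvents.

(** * The law of the random walk *)
Lemma sum_tupleS (R : nmodType) (A : finType) n (f : n.+1.-tuple A -> R) :
  \sum_t f t = \sum_a \sum_(t : n.-tuple A) f (cons_tuple a t).
Proof.
rewrite pair_big /= (reindex (fun at' : A * n.-tuple A => cons_tuple at'.1 at'.2))//=.
exists (fun t => (thead t, behead_tuple t)) => [[a t] _|t _] /=.
  by congr pair; apply: val_inj.
by rewrite [RHS]tuple_eta; apply: val_inj.
Qed.

Section WalkExpectation.
Context {R : realType} {d : measure_display} {T : measurableType d}.
Variable P : probability T R.
Variables (I : finType) (gT : I -> finGroupType).
Local Notation G := (freeprod gT).
Variables (A : finType) (e : A -> G) (law : G -> R) (Y : nat -> T -> G).
Hypotheses (e_inj : injective e) (a0 : A).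
Local Notation p := (fun a => law (e a)).
Hypotheses (law_ge0 : forall a, 0 <= law (e a)) (law_sum1 : \sum_a law (e a) = 1).
Hypothesis Y_walk : random_walk law P Y.

Lemma walkE_tuple n (f : G -> R) x :
  walkE e p n f x = \sum_(t : n.-tuple A) \prod_(a <- t) p a * f (x * \prod_(a <- t) e a)%g.
Proof.
elim: n x => [|n IH] x /=.
  rewrite (big_pred1 [tuple]) ?big_nil ?mul1r ?mulg1// => t.
  by rewrite [t]tuple0 /= eqxx.
rewrite sum_tupleS; apply: eq_bigr => a _; rewrite IH big_distrr /=.
by apply: eq_bigr => t _; rewrite !big_cons mulrA mulgA.
Qed.

Definition walk_path n (t : n.-tuple A) (k : nat) : G := (\prod_(a <- take k t) e a)%g.

Definition path_event n (t : n.-tuple A) : set T :=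
  [set w | forall k, (k <= n)%N -> Y k w = walk_path t k].

Lemma walk_pathS n (t : n.-tuple A) k : (k < n)%N ->
  walk_path t k.+1 = (walk_path t k * e (nth a0 t k))%g.
Proof.
move=> kn; rewrite /walk_path (take_nth a0) ?size_tuple//.
by rewrite -cats1 big_cat big_seq1.
Qed.

Lemma prob_path_event n (t : n.-tuple A) : P (path_event t) = (\prod_(a <- t) p a)%:E.
Proof.
rewrite Y_walk.2 {1}/walk_path take0 big_nil eqxx mul1r; congr EFin.
rewrite (big_nth a0) size_tuple big_mkord; apply: eq_bigr => k _.
by rewrite walk_pathS// mulgA mulVg mul1g.
Qed.

Lemma measurable_path_event n (t : n.-tuple A) : measurable (path_event t).
Proof.
rewrite (_ : path_event t = \bigcap_(k in [set k | (k <= n)%N]) (Y k @^-1` [set walk_path t k])).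
  by apply: bigcap_measurable; [exists 0%N|move=> k _; exact: Y_walk.1].
by apply/seteqP; split.
Qed.

Lemma path_event_inj n (t t' : n.-tuple A) w : path_event t w -> path_event t' w -> t = t'.
Proof.
move=> H H'; apply: eq_from_tnth => i.
rewrite !(tnth_nth a0); apply: e_inj.
have := H i.+1 (ltn_ord i); rewrite (H' i.+1 (ltn_ord i)) !walk_pathS//.
by rewrite -(H i (ltnW (ltn_ord i))) -(H' i (ltnW (ltn_ord i))) => /mulgI.
Qed.

Lemma measurable_preimage n (Q : set G) : measurable (Y n @^-1` Q).
Proof.
rewrite (_ : _ @^-1` _ = \bigcup_k (if unpickle k is Some x then
   if `[< Q x >] then Y n @^-1` [set x] else set0 else set0)).
  apply: bigcup_measurable => k _; case: unpickle => // x.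
  by case: ifP => // _; exact: Y_walk.1.
apply/seteqP; split=> w /=.
  by move=> Qw; exists (pickle (Y n w)) => //; rewrite pickleK; case: asboolP.
by move=> [k _]; case: unpickle => // x; case: asboolP => // Qx /= ->.
Qed.

(** The finitely many paths with steps in the alphabet have total probability 1, so
the expectation is the sum over these paths. *)
Lemma expectation_walk n (f : G -> R) : (forall y, 0 <= f y) ->
  ('E_P[fun w => f (Y n w)] = (walkE e p n f 1%g)%:E)%E.
Proof.
move=> f0; rewrite unlock.
pose g : T -> \bar R := fun w => (\sum_(t : n.-tuple A) (f (\prod_(a <- t) e a)%g)%:E * (\1_(path_event t) w)%:E)%E.
have [mU PU] := measure_finU P (fun t : n.-tuple A => true)
  (@measurable_path_event n) (@path_event_inj n).
have tot : \sum_(t : n.-tuple A) fine (P (path_event t)) = 1.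
  rewrite -[RHS](walkE_cst e law_sum1 n 1 1%g) walkE_tuple.
  by apply: eq_bigr => t _; rewrite prob_path_event mulr1.
have PC : P (~` [set w | exists2 t : n.-tuple A, true & path_event t w]) = 0%E.
  by rewrite probability_setC// PU tot subee.
have mf (h : G -> R) : measurable_fun setT (fun w => h (Y n w)).
  by move=> _ B mB; rewrite setTI; exact: (measurable_preimage n (h @^-1` B)).
have mi (t : n.-tuple A) : measurable_fun setT (fun w => \1_(path_event t) w : R).
  exact: measurable_indic (measurable_path_event t).
rewrite (ae_eq_integral g)//; last 3 first.
- by apply/measurable_EFinP; exact: mf.
- apply: emeasurable_sum => t; apply: emeasurable_funM; first exact: measurable_cst.
  by apply/measurable_EFinP; exact: mi.
- exists (~` [set w | exists2 t : n.-tuple A, true & path_event t w]); split.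
  + exact: measurableC.
  + exact: PC.
  + move=> w H /= [t _ tw]; apply: H => _; rewrite /g.
    rewrite (bigD1 t)//= indicE mem_set// mule1 [X in (_ + X)%E]big1 ?adde0.
      by rewrite (tw n (leqnn n)) /walk_path take_oversize// ?size_tuple.
    move=> u ut; rewrite indicE memNset ?mule0// => uw.
    by move: ut; rewrite (path_event_inj uw tw) eqxx.
rewrite ge0_integral_sum//; first last.
- by move=> t w _; rewrite mule_ge0// lee_fin.
- move=> t; apply: emeasurable_funM; first exact: measurable_cst.
  by apply/measurable_EFinP; exact: mi.
rewrite walkE_tuple -sumEFin; apply: eq_bigr => t _.
rewrite ge0_integralZl_EFin//.
- rewrite integral_indic//; last exact: measurable_path_event.
  by rewrite setIT mul1g EFinM muleC; congr (_ * _)%E; exact: prob_path_event.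
- by apply/measurable_EFinP; exact: mi.
Qed.

End WalkExpectation.

(** * The alphabet of steps *)
Section StepAlphabet.
Variables (R : realType) (I : finType) (gT : I -> finGroupType).
Variables (alpha : I -> R) (mu : forall i, gT i -> R).
Arguments mu : clear implicits.
Hypotheses (alpha_gt0 : forall i, 0 < alpha i) (alpha_sum1 : \sum_i alpha i = 1).
Hypotheses (mu_ge0 : forall i g, 0 <= mu i g) (mu_sum1 : forall i, \sum_g mu i g = 1).

Definition step_support : seq (freeprod gT) :=
  [seq fp_in (tagged a) | a : {i : I & gT i}].

(** A letter of the alphabet is a value of the steps and not a pair of a factor and
an element, because the identity belongs to all the factors: the steps then
determine the letters. *)
Definition alphabet : finType := seq_sub step_support.

Definition step (a : alphabet) : freeprod gT := val a.

Lemma step_inj : injective step. Proof. exact: val_inj. Qed.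

Lemma fp_in_support i (g : gT i) : fp_in g \in step_support.
Proof. by apply/fintype.imageP; exists (Tagged gT g). Qed.

Local Notation p := (fun a : alphabet => mixture alpha mu (step a)).

Lemma step_ge0 a : 0 <= p a.
Proof.
apply: sumr_ge0 => i _; rewrite mulr_ge0 ?(ltW (alpha_gt0 i))//.
by apply: sumr_ge0.
Qed.

Lemma sum_step (F : freeprod gT -> R) :
  \sum_a p a * F (step a) = \sum_i alpha i * \sum_g mu i g * F (fp_in g).
Proof.
rewrite /mixture; under eq_bigr do rewrite big_distrl.
rewrite exchange_big; apply: eq_bigr => i _ /=.
under eq_bigr do rewrite -mulrA big_distrl big_mkcond /=.
rewrite -big_distrr exchange_big /=; congr (_ * _); apply: eq_bigr => g _.
rewrite -big_mkcond /= (big_pred1 (SeqSub (fp_in_support g)))//.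
Qed.

Lemma step_sum1 : \sum_a p a = 1.
Proof.
transitivity (\sum_a p a * 1); first by apply: eq_bigr => a _; rewrite mulr1.
rewrite (sum_step (fun=> 1)) -[RHS]alpha_sum1; apply: eq_bigr => i _.
by rewrite -[RHS]mulr1 -[X in _ = _ * X](mu_sum1 i); congr (_ * _); apply: eq_bigr => g _; rewrite mulr1.
Qed.

(** The walk stays in the factor [i] during [k] steps with probability at least
[alpha i ^ k], and performs there a walk with law [mu i]. *)
Lemma walkE_factor i k (x g : gT i) :
  alpha i ^+ k * nstep (mu i) k x g <= walkE step p k (fun y => (y == fp_in g)%:R) (fp_in x).
Proof.
elim: k x => [|k IH] x /=.
  by rewrite mul1r (inj_eq (@fp_in_inj _ _ i)).
rewrite (sum_step (fun y => walkE step p k (fun y => (y == fp_in g)%:R) (fp_in x * y)%g)).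
rewrite (bigD1 i)//=; apply: ler_wpDr.
  apply: sumr_ge0 => j _; rewrite mulr_ge0 ?(ltW (alpha_gt0 j))//.
  by apply: sumr_ge0 => h _; rewrite mulr_ge0//; apply: walkE_ge0 => //; exact: step_ge0.
rewrite exprS -mulrA ler_wpM2l ?(ltW (alpha_gt0 i))// big_distrr /=.
rewrite (reindex_inj (mulgI x)) /=; apply: ler_sum => h _.
rewrite mulKg mulrCA ler_wpM2l// -fp_inM; exact: IH.
Qed.

Hypothesis mu_irr : forall i, irreducible_walk (mu i).

Lemma reach_letter i (g : gT i) :
  exists k, 0 < walkE step p k (fun y => (y == fp_in g)%:R) 1%g.
Proof.
have [k k0] := @mu_irr i 1%g g; exists k.
rewrite -(fp_in1 gT i); apply: lt_le_trans (walkE_factor _ _ _).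
by rewrite mulr_gt0// exprn_gt0.
Qed.

Lemma reach_mul k l (x y : freeprod gT) :
  0 < walkE step p k (fun z => (z == x)%:R) 1%g ->
  0 < walkE step p l (fun z => (z == y)%:R) 1%g ->
  0 < walkE step p (k + l) (fun z => (z == x * y)%g%:R) 1%g.
Proof.
move=> hx hy; apply: lt_le_trans (mulr_gt0 hx hy) _.
apply: walkE_mul_ge => // [a|u v]; first exact: step_ge0.
have [->|_] := eqVneq u x; last by rewrite mul0r.
have [->|_] := eqVneq v y; last by rewrite mulr0.
by rewrite eqxx mulr1.
Qed.

Section Lengths.
Variable S : forall i, {set gT i}.
Hypothesis S_generates : forall i, <<S i>>%g = [set: gT i]%SET.
Hypothesis gT_nontrivial : forall i, (1 < #|gT i|)%N.
Variables i1 i2 : I.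
Hypothesis i12 : i2 != i1.
Local Notation len := (word_length (fp_gens S)).

Lemma nontrivial_elt i : exists g : gT i, g != 1%g.
Proof.
apply/existsP; rewrite -negb_forall; apply/negP => /forallP H.
have := gT_nontrivial i; rewrite ltnNge => /negP; apply.
rewrite -(card1 (1%g : gT i)); apply/subset_leq_card/fintype.subsetP => g _.
exact: H.
Qed.

(** The elements of [complete_good] are reached by irreducibility on each
factor. *)
Lemma completion : exists (l r : bool * bool -> freeprod gT) (kl kr : bool * bool -> nat),
  [/\ forall j, 0 < walkE step p (kl j) (fun y => (y == l j)%:R) 1%g,
      forall j, 0 < walkE step p (kr j) (fun y => (y == r j)%:R) 1%g &
      forall x, exists j, good i1 (l j * x * r j)%g /\ (len x <= len (l j * x * r j)%g)%N].
Proof.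
have [a a1] := nontrivial_elt i1; have [b b1] := nontrivial_elt i2.
have [ka Ha] := reach_letter a; have [kb Hb] := reach_letter b.
exists (fun j => if j.1 then fp_in a * fp_in b else fp_in a)%g, (fun j => if j.2 then fp_in b else 1)%g.
exists (fun j => if j.1 then ka + kb else ka)%N, (fun j => if j.2 then kb else 0)%N.
split; last exact: (complete_good S_generates i12 a1 b1).
  by move=> [[] j] //=; exact: reach_mul.
by move=> [j []] //=; rewrite eqxx.
Qed.

Definition max_step : nat := \max_(a : alphabet) len (step a).

Lemma len_step a : (len (step a) <= max_step)%N.
Proof. exact: (leq_bigmax (F := fun a => len (step a))). Qed.

End Lengths.
End StepAlphabet.

(** * Exponential tails and the exponential growth rate *)
Section BorelCantelli.
Context {R : realType} {d : measure_display} {T : measurableType d}.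
Variable P : probability T R.

Lemma geometric_partial_sum_le (eta : R) n : 0 <= eta -> eta < 1 ->
  \sum_(0 <= k < n) eta ^+ k <= (1 - eta)^-1.
Proof.
move=> e0 e1; have h : 0 < 1 - eta by rewrite subr_gt0.
rewrite big_mkord -[leRHS]mul1r ler_pdivlMr//.
have -> : (\sum_(k < n) eta ^+ k) * (1 - eta) = 1 - eta ^+ n.
  by rewrite -[RHS]opprB subrX1 mulrC -mulNr opprB.
by rewrite gerBl exprn_ge0.
Qed.

Lemma borel_cantelli_geometric (U : nat -> set T) (c eta : R) n0 :
  (forall n, measurable (U n)) -> 0 <= c -> 0 <= eta < 1 ->
  (forall n, (n0 <= n)%N -> (P (U n) <= (c * eta ^+ n)%:E)%E) ->
  {ae P, forall w, exists n1, forall n, (n1 <= n)%N -> ~ U n w}.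
Proof.
move=> mU c0 /andP[e0 e1] PU.
pose F n := if (n0 <= n)%N then U n else set0.
have mF n : measurable (F n) by rewrite /F; case: ifP.
have PF n : (P (F n) <= (c * eta ^+ n)%:E)%E.
  rewrite /F; case: ifP => [|_]; first exact: PU.
  by rewrite measure0 lee_fin mulr_ge0// exprn_ge0.
have : P (lim_sup_set F) = 0%E.
  apply: lim_sup_set_cvg0 => //.
  apply: (@le_lt_trans _ _ (c / (1 - eta))%:E); last exact: ltry.
  apply: lime_le; first by apply: is_cvg_nneseries.
  apply: nearW => n; apply: le_trans (_ : (\sum_(0 <= k < n) (c * eta ^+ k)%:E <= _)%E).
    by apply: lee_sum => k _; exact: PF.
  rewrite sumEFin lee_fin -big_distrr /= ler_wpM2l//.
  exact: geometric_partial_sum_le.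
move=> L0; exists (lim_sup_set F); split => //.
  by apply: bigcap_measurable => [|k _]; [exists 0%N|apply: bigcup_measurable => j _].
move=> w /= H; move=> n _ /=; apply: contrapT => K; apply: H.
exists (n + n0)%N => m nm Um; apply: K; exists m => /=; first by move: nm; lia.
by rewrite /F; case: ifP => // /negP; case; move: nm; lia.
Qed.

End BorelCantelli.

Section Growth.
Variables (R : realType) (A : finType) (G : groupType) (e : A -> G) (p : A -> R).
Hypotheses (p_ge0 : forall a, 0 <= p a) (p_sum1 : \sum_a p a = 1).
Variables (len : G -> nat) (C : nat).
Hypothesis len1 : len 1%g = 0%N.
Hypothesis lenM : forall x y, (len (x * y)%g <= len x + len y)%N.
Hypothesis lene : forall a, (len (e a) <= C)%N.
Local Notation lmgf := (lmgf e p len).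
Local Notation lmean := (lmean e p len).

Definition rate (t : R) : R := limn (fun n => n%:R^-1 * ln (lmgf n t)).

Let mgf_gt0 n t : 0 < lmgf n t. Proof. exact: lmgf_gt0 lene n t. Qed.

Lemma rate_pos t : 0 <= t -> n%:R^-1 * ln (lmgf n t) @[n --> \oo] --> rate t /\
  forall n, (0 < n)%N -> rate t <= n%:R^-1 * ln (lmgf n t).
Proof.
move=> t0; have [||l [cl _ Hl]] := @fekete R (fun n => ln (lmgf n t)).
- by move=> n; rewrite ln_ge0// lmgf_ge1.
- move=> n m; rewrite -lnM ?posrE ?mgf_gt0// ler_ln ?posrE ?mulr_gt0 ?mgf_gt0//.
  exact: lmgf_subM.
by have -> : rate t = l by apply/cvg_lim.
Qed.

(** For negative [t] it is the opposite of the logarithm that is subadditive. *)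
Lemma rate_cvg t : n%:R^-1 * ln (lmgf n t) @[n --> \oo] --> rate t.
Proof.
have [t0|/ltW t0] := leP 0 t; first exact: (rate_pos t0).1.
have [||l [cl _ _]] := @fekete R (fun n => - ln (lmgf n t)).
- by move=> n; rewrite oppr_ge0 ln_le0// lmgf_le1.
- move=> n m; rewrite -opprD lerN2 -lnM ?posrE ?mgf_gt0//.
  by rewrite ler_ln ?posrE ?mulr_gt0 ?mgf_gt0//; exact: lmgf_superM.
have cl' : n%:R^-1 * ln (lmgf n t) @[n --> \oo] --> - l.
  rewrite (_ : (fun n => _) = fun n => - (n%:R^-1 * - ln (lmgf n t))); first exact: cvgN.
  by apply/funext => n; rewrite mulrN opprK.
by have -> : rate t = - l by apply/cvg_lim.
Qed.

(** [v] is the limit of the mean length divided by the time. *)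
Lemma speed_exists : exists2 v : R, 0 <= v & forall t, t * v <= rate t.
Proof.
have [||v [cv v0 _]] := @fekete R lmean.
- by move=> n; exact: lmean_ge0.
- by move=> n m; exact: lmean_subD.
exists v => // t.
have c1 : n%:R^-1 * (t * lmean n) @[n --> \oo] --> t * v.
  rewrite (_ : (fun n => _) = fun n => t * (n%:R^-1 * lmean n)); first exact: cvgMr.
  by apply/funext => n; rewrite mulrCA.
rewrite -(cvg_lim _ c1)// -(cvg_lim _ (@rate_cvg t))//.
apply: ler_lim; [by apply/cvg_ex; eexists; exact: c1|by apply/cvg_ex; eexists; exact: (@rate_cvg t)|].
apply: nearW => n; rewrite ler_wpM2l//.
by rewrite -[leLHS]expRK ler_ln ?posrE ?expR_gt0 ?mgf_gt0// lmgf_mean.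
Qed.

Lemma lmgf_lb n t (s : R) : (0 < n)%N -> 0 <= t -> s <= rate t -> expR (n%:R * s) <= lmgf n t.
Proof.
move=> n0 t0 st; rewrite -[leRHS]lnK ?posrE ?mgf_gt0// ler_expR.
have := (rate_pos t0).2 n n0; rewrite mulrC ler_pdivlMr ?ltr0n// mulrC.
by apply: le_trans; rewrite ler_wpM2l.
Qed.

Lemma lmgf_ub t (s : R) : 0 <= t -> rate t < s -> exists n0, forall n, (n0 <= n)%N ->
  lmgf n t <= expR (n%:R * s).
Proof.
move=> t0 st; have /cvgrPdist_le/(_ (s - rate t)) := @rate_cvg t.
rewrite subr_gt0 => /(_ st)[n0 _ H]; exists n0.+1 => n nn.
have n1 : (0 < n)%N by exact: leq_trans nn.
rewrite -[leLHS]lnK ?posrE ?mgf_gt0// ler_expR mulrC -ler_pdivrMr ?ltr0n//.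
have := H n (ltnW nn); rewrite /= distrC => /(le_trans (ler_norm _)).
by rewrite lerD2r mulrC.
Qed.

End Growth.

(** * Linear bounds on the maximal displacement *)
Section Speed.
Variables (R : realType) (I : finType) (gT : I -> finGroupType).
Variables (S : forall i, {set gT i}) (alpha : I -> R) (mu : forall i, gT i -> R).
Arguments mu : clear implicits.
Hypothesis gT_nontrivial : forall i, (1 < #|gT i|)%N.
Hypothesis S_symmetric : forall i s, s \in S i -> s^-1%g \in S i.
Hypothesis S_generates : forall i, <<S i>>%g = [set: gT i]%SET.
Hypotheses (alpha_gt0 : forall i, 0 < alpha i) (alpha_sum1 : \sum_i alpha i = 1).
Hypotheses (mu_ge0 : forall i g, 0 <= mu i g) (mu_sum1 : forall i, \sum_g mu i g = 1).
Hypothesis mu_irr : forall i, irreducible_walk (mu i).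
Variables (i1 i2 : I).
Hypothesis i12 : i2 != i1.
Variables (off : nat -> R) (rho : R).
Hypothesis off_ge0 : forall k, 0 <= off k.
Hypothesis off_sum1 : (\sum_(0 <= k <oo) (off k)%:E = 1)%E.
Hypothesis off_mean : (\sum_(0 <= k <oo) (k%:R * off k)%:E = rho%:E)%E.
Hypotheses (rho_gt1 : 1 < rho) (off0 : off 0%N = 0).
Variables (d : measure_display) (T : measurableType d) (P : probability T R).
Variables (N : seq nat -> T -> nat) (zeta : seq nat -> T -> freeprod gT).
Hypothesis N_iid : iid_with_law P N off.
Hypothesis zeta_iid : iid_given_tree P N zeta (mixture alpha mu).

Local Notation len := (word_length (fp_gens S)).
Local Notation A := (alphabet gT).
Local Notation e := (@step _ gT).
Local Notation p := (fun a : A => mixture alpha mu (e a)).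
Local Notation M := (max_displacement len N zeta).
Local Notation C := (max_step S).
Local Notation Lambda := (rate e p len).

Let p_ge0 a : 0 <= p a. Proof. exact: step_ge0. Qed.
Let p_sum1 : \sum_a p a = 1. Proof. exact: step_sum1. Qed.
Let len1 : len 1%g = 0%N. Proof. exact/word_length1/fp_gen_ex. Qed.
Let lenMle x y : (len (x * y)%g <= len x + len y)%N. Proof. exact: lenM. Qed.
Let lene a : (len (e a) <= C)%N. Proof. exact: len_step. Qed.
Let rho0 : 0 < rho. Proof. by apply: lt_trans rho_gt1. Qed.
Let a0 : A := SeqSub (fp_in_support (1%g : gT i1)).

Definition eval (a : seq A) : freeprod gT := (\prod_(x <- a) e x)%g.

Lemma brwE s w a : path_steps zeta w [::] s = map e a -> brw zeta s w = eval a.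
Proof. by move=> sa; rewrite /brw brw_path_steps sa big_map. Qed.

Lemma displacement_le n w (c : R) : 0 <= c ->
  (forall s, size s = n -> in_tree (N^~ w) s -> (len (brw zeta s w))%:R <= c) ->
  (M n w)%:R <= c.
Proof.
move=> c0 H; rewrite /max_displacement big_seq.
apply: (big_ind (fun m : nat => m%:R <= c)) => //.
  by move=> x y xc yc; rewrite /maxn; case: ifP.
by move=> s; rewrite mem_generation => /andP[/eqP sn ts]; exact: H.
Qed.

Lemma displacement_ge n w s : size s = n -> in_tree (N^~ w) s ->
  (len (brw zeta s w) <= M n w)%N.
Proof.
move=> sn ts; apply: (leq_bigmax_seq (F := fun s => len (brw zeta s w))) => //.
by rewrite mem_generation sn eqxx.
Qed.

Lemma pathE_eval n (f : freeprod gT -> R) :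
  pathE p n (fun a => f (eval a)) = walkE e p n f 1%g.
Proof.
rewrite -(pathE_walkE p e n f 1%g); congr pathE; apply/funext => a.
by rewrite mul1g.
Qed.

(** First moment bound and Markov's inequality, with half of the gap
[t * x - ln rho - Lambda t] spent on replacing [Lambda t] by the moment
generating function at time [n]. *)
Lemma displacement_upper x t : 0 <= x -> 0 < t -> ln rho + Lambda t < t * x ->
  {ae P, forall w, exists n1, forall n, (n1 <= n)%N -> (M n w)%:R <= x * n%:R}.
Proof.
move=> x0 t0 tx.
pose dl := (t * x - ln rho - Lambda t) / 2.
have dl0 : 0 < dl by rewrite divr_gt0//; lra.
have [n0 Hn0] : exists n0, forall n, (n0 <= n)%N -> lmgf e p len n t <= expR (n%:R * (Lambda t + dl)).
  by apply: (lmgf_ub p_ge0 p_sum1 len1 lenMle lene (ltW t0)); lra.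
pose B n : pred (seq A) := fun a => x * n%:R <= (len (eval a))%:R.
have HU n := hit_upper N_iid zeta_iid a0 (@step_inj _ _) p_ge0 p_sum1 off_ge0 off_sum1 off_mean n (B n).
pose U n := projT1 (cid2 (HU n)).
have mU n : measurable (U n) by rewrite /U; case: cid2.
have PU n : (P (U n) <= (rho ^+ n * pathE p n (fun a => (B n a)%:R))%:E)%E.
  by rewrite /U; case: cid2 => ? ? [].
have UH n w : ~ U n w -> forall s, size s = n -> in_tree (N^~ w) s ->
    exists2 a, path_steps zeta w [::] s = map e a & ~~ B n a.
  by rewrite /U; case: cid2 => ? ? [? H]; exact: H.
have := @borel_cantelli_geometric _ _ _ P U 1 (expR (- dl)) n0 mU ler01.
rewrite expR_ge0 expR_lt1 oppr_lt0 dl0 => /(_ isT) H.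
have {H} : {ae P, forall w, exists n1, forall n, (n1 <= n)%N -> ~ U n w}.
  apply: H => n nn; apply: le_trans (PU n) _; rewrite lee_fin mul1r.
  rewrite (pathE_eval n (fun y => (x * n%:R <= (len y)%:R)%R%:R)).
  apply: le_trans (ler_wpM2l _ (tail_mgf _ _ _ _ _ (ltW t0))) _ => //; first by rewrite exprn_ge0 ?ltW.
  apply: le_trans (_ : expR (n%:R * ln rho) * (expR (- (t * (x * n%:R))) * expR (n%:R * (Lambda t + dl))) <= _).
    rewrite expRM_natl lnK ?posrE// ler_wpM2l ?exprn_ge0 ?(ltW rho0)//.
    by rewrite ler_wpM2l ?expR_ge0// Hn0.
  by rewrite -!expRD -expRM_natl ler_expR /dl; lra.
apply: filterS => w [n1 Hn1]; exists n1 => n nn.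
apply: displacement_le; first by rewrite mulr_ge0.
move=> s sn ts; have [a sa] := UH n w (Hn1 n nn) s sn ts.
by rewrite -ltNge (brwE sa) => /ltW.
Qed.

Lemma chain_eval (y : R) b j (u : seq A) : 0 <= y -> size u = (j * b)%N ->
  chain (fun a => good i1 (eval a) && (y * b%:R <= (len (eval a))%:R)) b j u ->
  good i1 (eval u) /\ y * (j * b)%:R <= (len (eval u))%:R.
Proof.
move=> y0; elim: j u => [|j IH] u /=.
  move=> /size0nil -> _; rewrite /eval big_nil mul0n mulr0; split; [exact: good1|by []].
rewrite mulSn => su /andP[/andP[g1 l1]] /IH[].
  by rewrite size_drop su addKn.
move=> g2 l2; rewrite -(cat_take_drop b u) /eval big_cat -!/(eval _).
have [-> ->] := good_mul S_generates g1 g2; split=> //.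
by rewrite !natrD mulrDr lerD.
Qed.

Lemma len_eval (a : seq A) : (len (eval a) <= C * size a)%N.
Proof.
apply: leq_trans (word_length_prod (fp_gen_ex S_generates) _ _) _.
rewrite -sum1_size big_distrr /=; apply: leq_sum => x _.
by rewrite muln1; exact: lene.
Qed.

(** Generation [n = k + j * b] is reached by [k] free steps followed by [j] good
blocks of length [b].  Out of [D] consecutive stretches of length [b], one goes
to the free steps and [D - 1] to the blocks; a large [D] makes the loss of
speed smaller than the gap between [x] and [y], and [k], being proportional to
[n], makes the failure probability summable. *)
Lemma displacement_lower x x' : 0 <= x -> x < x' ->
  (forall t, 0 <= t -> t * x' <= ln rho + Lambda t) ->
  {ae P, forall w, exists n1, forall n, (n1 <= n)%N -> x * n%:R <= (M n w)%:R}.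
Proof.
move=> x0 xx' Hx'.
pose x1 := (x + x') / 2; pose eta := (x1 - x) / 2; pose y := x1 - eta.
have [x1_ge0 x1x' eta0 xy] : [/\ 0 <= x1, x1 < x', 0 < eta & x < y].
  by split; rewrite /y /eta /x1; lra.
have y0 : 0 <= y by exact: le_trans (ltW xy).
have [l [r [kl [kr [Hl Hr Hc]]]]] := completion alpha_gt0 mu_ge0 mu_irr S_generates gT_nontrivial i12.
have LB n t : (0 < n)%N -> 0 <= t -> expR (n%:R * (t * x' - ln rho)) <= lmgf e p len n t.
  move=> n0 t0; apply: (lmgf_lb p_ge0 p_sum1 len1 lenMle lene n0 t0).
  by rewrite lerBlDl Hx'.
have [b b0 Hb] := good_block p_ge0 p_sum1 len1 lenMle lene (good1 gT i1) (good_mul S_generates (i1:=i1))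
  Hl Hr Hc rho_gt1 x1_ge0 x1x' LB eta0.
pose W : pred (seq A) := fun a => good i1 (eval a) && (y * b%:R <= (len (eval a))%:R).
have {Hb} Hb : 1 < rho ^+ b * pathE p b (fun a => (W a)%:R).
  by rewrite (pathE_eval b (fun z => (good i1 z && (y * b%:R <= (len z)%:R))%R%:R)).
set q := pathE p b _ in Hb.
have q1 : q <= 1 by apply: pathE_le => // a; case: (W a).
have q0 : 0 < q by move: Hb; rewrite -(pmulr_rgt0 q (exprn_gt0 b rho0)); lra.
have bR : 0 < b%:R :> R by rewrite ltr0n.
  (* [m] is the [b]-th root of [1 / q], which is below [rho] as [rho ^ b * q > 1]. *)
pose m := expR (- ln q / b%:R).
have mbq : m ^+ b * q = 1.
  by rewrite -expRM_natr divfK ?gt_eqF// expRN lnK ?posrE// mulVf// gt_eqF.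
have m1 : 1 <= m by rewrite -expR0 ler_expR divr_ge0 ?ler0n// oppr_ge0 ln_le0.
have mrho : m < rho.
  rewrite -[ltRHS]lnK ?posrE// ltr_expR ltr_pdivrMr//.
  have : 0 < ln (rho ^+ b * q) by rewrite ln_gt0.
  by rewrite lnM ?posrE ?exprn_gt0// lnXn// -mulr_natr; lra.
have [K0 HK] := trunc_mean_cvg off_ge0 off_sum1 off_mean mrho.
have {HK} := HK K0.+1 (leqnSn _).
set K := K0.+1; set qK := (fun k : 'I_K.+1 => trunc_law off K k) => mK.
have [theta /andP[t0 t1] Ht] : exists2 theta : R, 0 <= theta < 1 & forall k j,
    1 - surv p qK (k + j * b) (fun w => (chain W b j (drop k w))%:R) <= theta ^+ k.
  apply: (@surv_restart R A p K qK p_ge0 p_sum1 _ _ m) => //.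
  - by move=> k; exact: trunc_law_ge0 off_ge0 off_sum1 K k.
  - exact: trunc_law_sum1.
  - exact: le_trans ler01 m1.
  - exact: le_trans m1 (ltW mK).
  - by rewrite mbq.
  (* Per stretch of [D] blocks, the gain [(D - 1) * y] has to cover [D * x] and the
     loss [C] caused by the free steps, up to the factor [b]. *)
have [D' HD] : exists D', 1 <= D'.+1%:R * (y - x) - y - C%:R.
  have [n0 Hn0] := @nat_multiple_ge R (y - x) (1 + y + C%:R) ltac:(lra).
  by exists n0; have := Hn0 n0.+1 (leqnSn _); lra.
pose D := D'.+1; pose L := (b * D)%N.
have L0 : (0 < L)%N by rewrite muln_gt0 b0.
have LR : 0 < L%:R :> R by rewrite ltr0n.
pose Q n := (n %/ L)%N; pose j n := (Q n * D')%N; pose k n := (Q n * b + n %% L)%N.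
have nE n : (k n + j n * b)%N = n.
  rewrite [RHS](divn_eq n L) -/(Q n) /k /j /L /D.
  by rewrite addnAC; congr (_ + _)%N; rewrite mulnS mulnDr -mulnA [(D' * b)%N]mulnC.
pose B n : pred (seq A) := fun a => chain W b (j n) (drop (k n) a).
have /choice[U HU] n := hit_lower N_iid zeta_iid a0 (@step_inj _ _) p_sum1 K n (B n).
  (* [theta] may vanish; [th] is a positive substitute, with a logarithm. *)
pose th := (theta + 1) / 2.
have th0 : 0 < th by rewrite /th; lra.
have th1 : th < 1 by rewrite /th; lra.
have tth : theta <= th by rewrite /th; lra.
pose h := expR (ln th / L%:R).
have lnth : ln th < 0 by rewrite ln_lt0// th0.
have h01 : 0 <= h < 1.
  by rewrite expR_ge0 expR_lt1 pmulr_llt0 ?invr_gt0// lnth.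
have PU n : (P (U n) <= (th^-1 * h ^+ n)%:E)%E.
  have [_ -> _] := HU n; rewrite lee_fin.
  have := Ht (k n) (j n); rewrite nE => /le_trans; apply.
  apply: le_trans (_ : th ^+ Q n <= _).
    apply: le_trans (_ : th ^+ k n <= _); first by rewrite lerXn2r ?nnegrE// ltW.
    apply: ler_wiXn2l; [exact: ltW|exact: ltW|].
    by rewrite /k (leq_trans (leq_pmulr _ b0))// leq_addr.
  have -> : th^-1 * h ^+ n = expR (n%:R / L%:R * ln th - ln th).
    rewrite expRD expRN lnK ?posrE// mulrC /h -expRM_natr; congr (expR _ * _); ring.
  rewrite -{1}(lnK (x := th)) ?posrE// -expRM_natl ler_expR.
  have : n%:R / L%:R <= (Q n)%:R + 1 :> R.
    rewrite ler_pdivrMr// natr1 -natrM ler_nat; exact: ltnW (ltn_ceil _ L0).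
  by nra.
have := @borel_cantelli_geometric _ _ _ P U th^-1 h 0 _ _ h01 (fun n _ => PU n).
have -> : 0 <= th^-1 by rewrite invr_ge0 ltW.
move=> /(_ (fun n => let: And3 mU _ _ := HU n in mU) isT).
have [Q0 HQ0] := @nat_multiple_ge R 1 ((x + C%:R) * D%:R) ltr01.
apply: filterS => w [n1 Hn1]; exists (n1 + Q0 * L)%N => n nn.
have [_ _ /(_ w)] := HU n; case/(_ (Hn1 n _)); first by apply: leq_trans nn; exact: leq_addr.
move=> s [a [sn Ba ts sa]].
have an : size a = n by rewrite -[RHS]sn -(size_map e) -sa; elim: (s) ([::] : seq nat) => //= i u IH v; rewrite IH.
have [|_ glen] := @chain_eval y b (j n) (drop (k n) a) y0 _ Ba.
  by rewrite size_drop an -{1}(nE n) addKn.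
  (* The free steps lower the length by at most [C * k n]. *)
have lena : (len (eval (drop (k n) a)) <= C * k n + len (eval a))%N.
  have -> : eval (drop (k n) a) = ((eval (take (k n) a))^-1 * eval a)%g.
    by rewrite -{3}(cat_take_drop (k n) a) /eval big_cat mulgA mulVg mul1g.
  apply: leq_trans (lenMle _ _) _; rewrite leq_add2r lenV//.
  apply: leq_trans (len_eval _) _; rewrite leq_mul2l size_take_min geq_minl orbT//.
have Mn : (len (eval a) <= M n w)%N by rewrite -(brwE sa); exact: displacement_ge.
have QQ : (Q0 <= Q n)%N.
  by rewrite /Q leq_divRL// (leq_trans _ nn)// leq_addl.
have {HQ0} HQ := HQ0 (Q n) QQ; rewrite mulr1 in HQ.
have sL : (n %% L < L)%N by rewrite ltn_mod.
move: glen; rewrite natrM natrM => glen.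
have {lena} len_le : (len (eval (drop (k n) a)))%:R <= C%:R * (k n)%:R + (M n w)%:R :> R.
  by rewrite -natrM -natrD ler_nat (leq_trans lena)// leq_add2l.
have nR : n%:R = (k n)%:R + (Q n)%:R * D'%:R * b%:R :> R by rewrite -!natrM -natrD -[in LHS](nE n).
have kR : (k n)%:R = (Q n)%:R * b%:R + (n %% L)%:R :> R by rewrite -natrM -natrD.
have : (n %% L)%:R <= b%:R * D%:R :> R by rewrite -natrM ler_nat ltnW.
have DR : D%:R = D'%:R + 1 :> R by rewrite -natr1.
have s0 : 0 <= (n %% L)%:R :> R by [].
have C0 : 0 <= C%:R :> R by [].
have Qn0 : 0 <= (Q n)%:R :> R by [].
rewrite nR kR => sD; rewrite -/D DR in HD HQ sD *.

have xC : 0 <= x + C%:R by rewrite addr_ge0.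
have QB : 0 <= (Q n)%:R * b%:R :> R by rewrite mulr_ge0.
have := ler_wpM2l QB HD; have := ler_wpM2r (ltW bR) HQ; have := ler_wpM2l xC sD.
rewrite kR in len_le; move: glen len_le; lra.
Qed.

End Speed.

(** * The speed of the maximum *)
Lemma cvg_squeeze_inv (R : realType) (u : nat -> R) (V : R) :
  (forall k, exists n1, forall n, (n1 <= n)%N ->
     (V - k.+1%:R^-1) * n%:R <= u n <= (V + k.+1%:R^-1) * n%:R) ->
  (u n / n%:R)%:E @[n --> \oo] --> V%:E.
Proof.
move=> H; apply: cvg_EFin; first exact: nearW.
apply/cvgrPdist_le => eps eps0 /=.
have [k ke] : exists k, k.+1%:R^-1 <= eps.
  exists (Num.bound eps^-1); rewrite invf_ple ?posrE//.
  by apply: le_trans (ltW (archi_boundP _)) _; rewrite ?ler_nat// invr_ge0 ltW.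
have [n1 Hn1] := H k; exists n1.+1 => // n /= nn.
have n0 : 0 < n%:R :> R by rewrite ltr0n; exact: leq_trans nn.
have /andP[h1 h2] := Hn1 n (ltnW nn).
have l1 : V - k.+1%:R^-1 <= u n / n%:R by rewrite ler_pdivlMr.
have l2 : u n / n%:R <= V + k.+1%:R^-1 by rewrite ler_pdivrMr.
rewrite distrC ler_norml lerBrDr lerBlDl; apply/andP; split.
  by apply: le_trans l1; rewrite addrC lerD2l lerN2.
by apply: le_trans l2 _; rewrite lerD2l.
Qed.

Theorem theorem1 (R : realType)
  (* the free product and its generating set *)
  (r : nat) (r_ge2 : (2 <= r)%N)
  (gT : 'I_r -> finGroupType) (gT_nontrivial : forall k, (1 < #|gT k|)%N)
  (S : forall k, {set gT k})
  (S_nontrivial : forall k, 1%g \notin S k)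
  (S_symmetric : forall k s, s \in S k -> s^-1%g \in S k)
  (S_generates : forall k, <<S k>>%g = [set: gT k]%SET)
  (* the step distribution *)
  (alpha : 'I_r -> R) (mu : forall k, gT k -> R)
  (alpha_gt0 : forall k, 0 < alpha k) (alpha_sum1 : \sum_k alpha k = 1)
  (mu_ge0 : forall k g, 0 <= mu k g) (mu_sum1 : forall k, \sum_g mu k g = 1)
  (mu_irr : forall k, irreducible_walk (mu k))
  (r2 : r = 2%N -> exists k, (2 < #|gT k|)%N)
  (* the random walk *)
  (dY : measure_display) (TY : measurableType dY) (PY : probability TY R)
  (Y : nat -> TY -> freeprod gT)
  (Y_walk : random_walk (mixture alpha mu) PY Y)
  (* the offspring distribution *)
  (off : nat -> R) (rho : R)
  (off_ge0 : forall k, 0 <= off k)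
  (off_sum1 : (\sum_(0 <= k <oo) (off k)%:E = 1)%E)
  (off_mean : (\sum_(0 <= k <oo) (k%:R * off k)%:E = rho%:E)%E)
  (rho_gt1 : 1 < rho) (off0 : off 0%N = 0)
  (* the Galton-Watson tree and the branching random walk *)
  (d : measure_display) (T : measurableType d) (P : probability T R)
  (N : seq nat -> T -> nat) (zeta : seq nat -> T -> freeprod gT)
  (N_iid : iid_with_law P N off)
  (zeta_iid : iid_given_tree P N zeta (mixture alpha mu)) :
  let len := word_length (fp_gens S) in
  let Lambda := log_mgf_rate PY (fun n w => len (Y n w)) in
  let I := legendre Lambda in
  let D_I := legendre_dom Lambda in
  let vmax := ereal_sup [set x%:E | x in [set x | D_I x /\ (I x <= (ln rho)%:E)%E]] in
  {ae P, forall w,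
    ((max_displacement len N zeta n w)%:R / n%:R)%:E @[n --> \oo] --> vmax}.
Proof.
pose i1 := Ordinal (ltnW r_ge2); pose i2 := Ordinal r_ge2.
have i12 : i2 != i1 by [].
pose p (a : alphabet gT) := mixture alpha mu (step a).
move=> len Lambda.
have p_ge0 a : 0 <= p a by exact: step_ge0.
have p_sum1 : \sum_a p a = 1 by exact: step_sum1.
pose a0 : alphabet gT := SeqSub (fp_in_support (1%g : gT i1)).
have LE : Lambda = rate (@step _ gT) p len.
  apply/funext => t; rewrite /Lambda /log_mgf_rate /rate; congr (limn _).
  apply/funext => n; congr (_ * ln _).
  have E := expectation_walk (@step_inj _ _) a0 p_sum1 Y_walk n (fun y => expR_ge0 (t * (len y)%:R)).
  by rewrite E.
move=> I D_I vmax.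
have len1 : len 1%g = 0%N by exact/word_length1/fp_gen_ex.
have lenMle x y : (len (x * y)%g <= len x + len y)%N by exact: lenM.
have lene a : (len (step a) <= max_step S)%N by exact: len_step.
have lam0 : 0 < ln rho by rewrite ln_gt0.
have [v v0 Hv] := speed_exists p_ge0 p_sum1 len1 lenMle lene.
rewrite -LE in Hv.
have [V [VE vV Hup Hlow]] := rate_speed_fin lam0 v0 Hv.
have -> : vmax = V%:E by exact: VE.
have V0 : 0 <= V by exact: le_trans vV.
have k0 k : 0 < k.+1%:R^-1 :> R by rewrite invr_gt0.
have up k : {ae P, forall w, exists n1, forall n, (n1 <= n)%N ->
    (max_displacement len N zeta n w)%:R <= (V + k.+1%:R^-1) * n%:R}.
  have [|t t0 Ht] := Hup (V + k.+1%:R^-1); first by rewrite ltrDl.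
  rewrite LE in Ht.
  apply: displacement_upper N_iid zeta_iid _ t _ t0 Ht => //.
  by rewrite addr_ge0// ltW.
have low k : {ae P, forall w, exists n1, forall n, (n1 <= n)%N ->
    (V - k.+1%:R^-1) * n%:R <= (max_displacement len N zeta n w)%:R}.
  have [x0|xn] := leP 0 (V - k.+1%:R^-1); last first.
    apply: aeW => w; exists 0%N => n _; apply: (@le_trans _ _ 0) => //.
    by rewrite mulr_le0_ge0// ltW.
  have [|x' xx' Hx'] := Hlow (V - k.+1%:R^-1); first by rewrite gtrBl.
  rewrite LE in Hx'.
  exact: (displacement_lower gT_nontrivial S_symmetric S_generates alpha_gt0 alpha_sum1 mu_ge0 mu_sum1 mu_irr
    i12 off_ge0 off_sum1 off_mean rho_gt1 off0 N_iid zeta_iid x0 xx' Hx').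
have /ae_foralln H : forall k, {ae P, forall w, exists n1, forall n, (n1 <= n)%N ->
   (V - k.+1%:R^-1) * n%:R <= (max_displacement len N zeta n w)%:R <= (V + k.+1%:R^-1) * n%:R}.
  move=> k; have U := up k; have W := low k; move: U W; apply: filterS2 => w [n1 H1] [n2 H2].
  exists (n1 + n2)%N => n nn; apply/andP; split.
    by apply: H2; apply: leq_trans nn; exact: leq_addl.
  by apply: H1; apply: leq_trans nn; exact: leq_addr.
by apply: filterS H => w Hw; exact: cvg_squeeze_inv.
Qed.
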